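(* Let $\mathfrak g$ be a finite-dimensional semisimple Lie algebra over $\mathbb C$ with Cartan subalgebra $\mathfrak h$, root system $\Delta\subseteq\mathfrak h^*$ and root decomposition $\mathfrak g=\mathfrak h\oplus\sum_{\alpha\in\Delta}\mathbb Cx_\alpha$. All homogeneous conformal averaging operators $T_\lambda=\sum_{n=0}^N\frac{\lambda^n}{n!}T_n$ on $\mathfrak g$ (with $\mathfrak h\subseteq T_*(\mathfrak g)$) are described as follows. For a root subsystem $\Delta'$ of $\Delta$, $$T_\lambda(x_\alpha)=\xi_\alpha x_\alpha,\quad T_\lambda(h_\alpha)=\xi_\alpha h_\alpha,\qquad \alpha\in\Delta',\ h_\alpha=[x_\alpha,x_{-\alpha}],$$ where $\xi_\alpha\in\mathbb C$ are nonzero constants that depend on the decomposition into simple summands of the semisimple Lie algebra $\mathfrak g_0$ generated by $x_\alpha$, $\alpha\in\Delta'$ (that is, $T_\lambda$ acts on each simple summand of $\mathfrak g_0$ as a nonzero scalar). The subalgebra $$\mathfrak h_0^\perp=\{h\in\mathfrak h\mid\alpha(h)=0,\ \alpha\in\Delta'\}$$ is invariant with respect to $T_\lambda$, and there are no restrictions on the linear functions $T_n|_{\mathfrak h_0^\perp}$ ($0\le n\le N$). The other root spaces $\mathbb Cx_\beta$, $\beta\in\Delta\setminus\Delta'$, belong to the kernel of $T_\lambda$.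
   Context: All spaces are over $\mathbb C$. A conformal averaging operator on a Lie algebra $\mathfrak g$ is a linear map $T_\lambda:\mathfrak g\to\mathfrak g[\lambda]$ ($\lambda,\mu$ formal variables) such that $$T_{\lambda+\mu}([T_\lambda (x),y]) = [T_\lambda (x), T_\mu(y)] \in \mathfrak g[\lambda, \mu ]\quad\text{for all }x,y\in\mathfrak g,$$ where maps and brackets are extended linearly in the polynomial variables; for finite-dimensional $\mathfrak g$ one writes $T_\lambda=\sum_{n=0}^N\frac{\lambda^n}{n!}T_n$ with $T_n$ linear transformations of $\mathfrak g$. For a subspace $B\subseteq\mathfrak g$, $T_*(B)$ denotes the linear span of all $T_\alpha(b)$, $b\in B$, $\alpha\in\mathbb C$, where $T_\alpha(b)$ is the value of the polynomial $T_\lambda(b)$ at $\lambda=\alpha$. For $\mathfrak g$ semisimple, $T_\lambda$ is called homogeneous if $T_*(\mathfrak g)$ contains a Cartan subalgebra of $\mathfrak g$. Invariance of $\mathfrak h_0^\perp$ means $T_n(\mathfrak h_0^\perp)\subseteq\mathfrak h_0^\perp$ for all $n$. A root subsystem of $\Delta$ is here a (possibly empty) subset $\Delta'\subseteq\Delta$ with $-\Delta'=\Delta'$ and such that $\alpha,\beta\in\Delta'$, $\alpha+\beta\in\Delta$ imply $\alpha+\beta\in\Delta'$. The elements $x_\alpha$ are fixed nonzero root vectors.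
   Formalization: Arbitrary T_n on h_0^⊥ always give an averaging operator, but not always a homogeneous one (Δ' empty, T=0); so the converse asserts averaging, and h ⊆ T_*(g) is shown to hold exactly when h_0^⊥ ⊆ T_*(h_0^⊥). *)

(* Defs.v *)
From HB Require Import structures.
From mathcomp Require Export all_boot all_order all_algebra.
From mathcomp Require Export reals.
From mathcomp Require Export complex.

Set Implicit Arguments.
Unset Strict Implicit.
Unset Printing Implicit Defensive.

Import GRing.Theory.
Local Open Scope ring_scope.

HB.mixin Record isLieAlgebra (F : fieldType) V of Vector F V := {
  lie : V -> V -> V;
  lie_linearl : forall y, linear (fun x => lie x y);
  lie_linearr : forall x, linear (lie x);
  liexx : forall x, lie x x = 0;
  lie_jacobi : forall x y z,
    lie x (lie y z) + lie y (lie z x) + lie z (lie x y) = 0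
}.

#[short(type="lieAlgType")]
HB.structure Definition LieAlgebra (F : fieldType) :=
  {V of isLieAlgebra F V & Vector F V}.

Section LieTheory.
Variables (F : fieldType) (g : lieAlgType F).
Implicit Types (U V W I J S H : {vspace g}) (x y v : g).

(* [U, V], the span of all brackets; by bilinearity bases of U and V suffice. *)
Definition lie_prod U V : {vspace g} :=
  <<[seq lie u v | u <- vbasis U, v <- vbasis V]>>%VS.

Definition subalgebra U := forall x y, x \in U -> y \in U -> lie x y \in U.

Definition lie_ideal U I := (I <= U)%VS /\ (lie_prod U I <= I)%VS.

Definition lie_solvable U := exists k, iter k (fun V => lie_prod V V) U = 0%VS.

Definition lie_nilpotent U := exists k, iter k (lie_prod U) U = 0%VS.

Definition lie_semisimple U :=
  forall I, lie_ideal U I -> lie_solvable I -> I = 0%VS.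

Definition lie_simple U :=
  lie_prod U U <> 0%VS /\ forall I, lie_ideal U I -> I = 0%VS \/ I = U.

Definition simple_decomposition U (s : seq {vspace g}) :=
  [/\ forall S, S \in s -> lie_ideal U S /\ lie_simple S,
      U = (\sum_(S <- s) S)%VS & directv (\sum_(S <- s) S)].

Definition simple_summand U S := exists2 s, simple_decomposition U s & S \in s.

Definition cartan H :=
  [/\ subalgebra H, lie_nilpotent H &
      forall x, (forall y, y \in H -> lie x y \in H) -> x \in H].

(* The subalgebra generated by s: the chain U, U + [U, U], ... starting from
   the span of s is stationary after \dim g steps, so this is the smallest
   subalgebra containing s: see sub_lie_gen, lie_gen_subalg, lie_gen_min. *)
Definition lie_gen (s : seq g) : {vspace g} :=
  iter (\dim {:g}) (fun U => U + lie_prod U U)%VS <<s>>%VS.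

(* Elements of g[lambda, mu] are represented by their coefficients: P i j is
   the coefficient of lambda^i mu^j, and likewise P n for g[lambda].  An
   operator T_lambda = \sum_(n <= N) lambda^n / n! T_n is given by the
   sequence T of the T_n, with T n = 0 for n > N. *)
Definition degree_le (N : nat) (T : nat -> 'End(g)) :=
  forall n, (N < n)%N -> T n = 0.

(* T_lambda (x) *)
Definition Tpoly (T : nat -> 'End(g)) x : nat -> g :=
  fun n => (n`!%:R)^-1 *: T n x.

Definition cpoly v : nat -> g := fun n => if n == 0%N then v else 0.

(* The embeddings of g[lambda] and g[mu] into g[lambda, mu]. *)
Definition in_lambda (P : nat -> g) : nat -> nat -> g :=
  fun i j => if j == 0%N then P i else 0.

Definition in_mu (P : nat -> g) : nat -> nat -> g :=
  fun i j => if i == 0%N then P j else 0.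

Definition lie2 (P Q : nat -> nat -> g) : nat -> nat -> g := fun i j =>
  \sum_(a < i.+1) \sum_(b < j.+1) lie (P a b) (Q (i - a)%N (j - b)%N).

(* T_(lambda + mu) (x), by Newton's binomial formula *)
Definition Tpoly2 (T : nat -> 'End(g)) x : nat -> nat -> g :=
  fun i j => 'C(i + j, i)%:R *: Tpoly T x (i + j)%N.

(* The extension of T_(lambda + mu) to g[lambda, mu], linear in the
   polynomial variables *)
Definition Tpoly2_ext (T : nat -> 'End(g)) (P : nat -> nat -> g) :
  nat -> nat -> g := fun i j =>
  \sum_(a < i.+1) \sum_(b < j.+1) Tpoly2 T (P a b) (i - a)%N (j - b)%N.

Definition averaging (T : nat -> 'End(g)) := forall x y i j,
  Tpoly2_ext T (lie2 (in_lambda (Tpoly T x)) (in_lambda (cpoly y))) i j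
  = lie2 (in_lambda (Tpoly T x)) (in_mu (Tpoly T y)) i j.

Definition Tval (N : nat) (T : nat -> 'End(g)) (a : F) x : g :=
  \sum_(n < N.+1) a ^+ n *: Tpoly T x n.

(* T_*(B) as a set: v lies in the span of finitely many T_a(b), b in B *)
Definition Tstar (N : nat) (T : nat -> 'End(g)) (B : g -> Prop) v :=
  exists2 s : seq g,
    forall w, w \in s -> exists a, exists2 b, B b & w = Tval N T a b
  & v \in <<s>>%VS.

Definition sub_Tstar H (N : nat) (T : nat -> 'End(g)) :=
  forall v, v \in H -> Tstar N T (fun=> True) v.

Definition homogeneous (N : nat) (T : nat -> 'End(g)) :=
  exists2 H, cartan H & sub_Tstar H N T.

Section Roots.
Variable h : {vspace g}.

Definition hdual := 'Hom(subvs_of h, F^o).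
Implicit Types (a b : hdual) (D : seq hdual).

Definition weight_vector a v :=
  forall t : subvs_of h, lie (vsval t) v = (a t : F) *: v.

Definition is_root a := a != 0 /\ exists2 v, v != 0 & weight_vector a v.

Definition root_system D := uniq D /\ forall a, a \in D <-> is_root a.

Definition root_decomposition D (x : hdual -> g) :=
  [/\ forall a, a \in D -> x a != 0 /\ weight_vector a (x a),
      {:g}%VS = (h + \sum_(a <- D) <[x a]>)%VS
    & directv (h + \sum_(a <- D) <[x a]>)].

Definition root_subsystem D (D' : seq hdual) :=
  [/\ {subset D' <= D}, forall a, a \in D' -> - a \in D' &
      forall a b, a \in D' -> b \in D' -> a + b \in D -> a + b \in D'].

Definition coroot (x : hdual -> g) a : g := lie (x a) (x (- a)).

Definition root_subalgebra (x : hdual -> g) (D' : seq hdual) : {vspace g} :=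
  lie_gen [seq x a | a <- D'].

Definition h0perp (D' : seq hdual) v :=
  v \in h /\ forall a, a \in D' -> a (vsproj h v) = 0.

(* The xi a are nonzero and only depend on the simple summand of the root
   subalgebra which contains x a. *)
Definition summand_constants (x : hdual -> g) (D' : seq hdual)
    (xi : hdual -> F) :=
  (forall a, a \in D' -> xi a != 0) /\
  forall S, simple_summand (root_subalgebra x D') S ->
  forall a b, a \in D' -> b \in D' -> x a \in S -> x b \in S -> xi a = xi b.

Definition described D (x : hdual -> g) (D' : seq hdual)
    (xi : hdual -> F) (T : nat -> 'End(g)) :=
  [/\ forall a, a \in D' -> Tpoly T (x a) =1 cpoly (xi a *: x a),
      forall a, a \in D' ->
        Tpoly T (coroot x a) =1 cpoly (xi a *: coroot x a),
      forall n v, h0perp D' v -> h0perp D' (T n v)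
    & forall b, b \in D -> b \notin D' -> Tpoly T (x b) =1 cpoly 0].

Definition scalar_on_summands (x : hdual -> g) (D' : seq hdual)
    (T : nat -> 'End(g)) :=
  forall S, simple_summand (root_subalgebra x D') S ->
  exists2 c : F, c != 0 & forall v, v \in S -> Tpoly T v =1 cpoly (c *: v).

End Roots.

Lemma lieDl x y z : lie (x + y) z = lie x z + lie y z.
Proof. by have := lie_linearl z 1 x y; rewrite !scale1r. Qed.

Lemma lieDr x y z : lie x (y + z) = lie x y + lie x z.
Proof. by have := lie_linearr x 1 y z; rewrite !scale1r. Qed.

Lemma lie0l y : lie 0 y = 0.
Proof. by apply: (addrI (lie 0 y)); rewrite -lieDl !addr0. Qed.

Lemma lie0r x : lie x 0 = 0.
Proof. by apply: (addrI (lie x 0)); rewrite -lieDr !addr0. Qed.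

Lemma lieZl c x y : lie (c *: x) y = c *: lie x y.
Proof. by have := lie_linearl y c x 0; rewrite !addr0 lie0l addr0. Qed.

Lemma lieZr c x y : lie x (c *: y) = c *: lie x y.
Proof. by have := lie_linearr x c y 0; rewrite !addr0 lie0r addr0. Qed.

Lemma lie_suml (K : Type) (r : seq K) (f : K -> g) y :
  lie (\sum_(i <- r) f i) y = \sum_(i <- r) lie (f i) y.
Proof.
exact: (big_morph (fun x => lie x y) (fun u v => lieDl u v y) (lie0l y)).
Qed.

Lemma lie_sumr (K : Type) (r : seq K) (f : K -> g) x :
  lie x (\sum_(i <- r) f i) = \sum_(i <- r) lie x (f i).
Proof. exact: (big_morph (lie x) (lieDr x) (lie0r x)). Qed.

Lemma mem_lie_prod U V x y :
  x \in U -> y \in V -> lie x y \in lie_prod U V.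
Proof.
move=> /coord_vbasis-> /coord_vbasis->.
rewrite lie_suml; apply: memv_suml => i _; rewrite lieZl; apply: memvZ.
rewrite lie_sumr; apply: memv_suml => j _; rewrite lieZr; apply: memvZ.
by apply: memv_span; apply: allpairs_f; rewrite mem_nth ?size_tuple.
Qed.

Lemma lie_prod_subP U V W :
  (forall x y, x \in U -> y \in V -> lie x y \in W) <-> (lie_prod U V <= W)%VS.
Proof.
split=> [UVW | /subvP sUVW x y Ux Vy]; last exact/sUVW/mem_lie_prod.
apply/span_subvP => _ /allpairsP[[u v] [/= Uu Vv ->]].
by apply: UVW; apply: vbasis_mem.
Qed.

Lemma sub_lie_gen s : (<<s>> <= lie_gen s)%VS.
Proof.
rewrite /lie_gen; elim: (\dim _) => //= n IHn.
exact: subv_trans IHn (addvSl _ _).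
Qed.

Lemma lie_gen_min s W :
  subalgebra W -> {subset s <= W} -> (lie_gen s <= W)%VS.
Proof.
move=> Wlie sW; rewrite /lie_gen; elim: (\dim _) => [|n IHn] /=.
  exact/span_subvP.
rewrite subv_add IHn; apply/lie_prod_subP => x y Ux Uy.
by apply: Wlie; apply: (subvP IHn).
Qed.

Lemma iter_stationary (f : {vspace g} -> {vspace g}) U n :
  (forall V, (V <= f V)%VS) ->
  f (iter n f U) = iter n f U \/ (n <= \dim (iter n f U))%N.
Proof.
move=> subf; elim: n => [|n IHn]; first by right.
rewrite iterS; set V := iter n f U in IHn *.
have [fixV|nfixV] := eqVneq (f V) V; first by left; rewrite !fixV.
case: IHn => [/eqP|leV]; first by rewrite (negPf nfixV).
right; apply: leq_ltn_trans leV _; rewrite ltn_neqAle dimvS ?subf // andbT.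
by apply: contra nfixV => /eqP dimV; rewrite eq_sym eqEdim subf dimV /=.
Qed.

Lemma lie_gen_subalg s : subalgebra (lie_gen s).
Proof.
have Gfix : (lie_gen s + lie_prod (lie_gen s) (lie_gen s))%VS = lie_gen s.
  have [//|] := iter_stationary <<s>>%VS (\dim {:g})
    (fun V => addvSl V (lie_prod V V)).
  rewrite -/(lie_gen s) => dimG.
  have -> : lie_gen s = {:g}%VS by apply/eqP; rewrite eqEdim subvf.
  by apply/eqP; rewrite eqEsubv subvf addvSl.
by apply/lie_prod_subP; rewrite -{3}Gfix addvSr.
Qed.

End LieTheory.

(* Main.v *)
(* The root spaces are lines by hypothesis, and h is abelian, as the last
   nonzero term of its lower central series would be central in g.  Traces along
   root strings give b(h_a) = r a(h_a) with r rational; so the radical of the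
   Killing form contains no nonzero coroot, the root vectors in it span an ideal
   without weight zero, and Engel's theorem produces a nonzero abelian ideal.  Hence the
   Killing form pairs x_a with x_(-a), and it is definite on the real span of
   the coroots.  This gives h = h_0 + h_0^perp, the distinctness of the roots of
   a subsystem on h_0, and so a bijection between the ideals of the root
   subalgebra g_0 and the splittings of the subsystem.

   Writing P_n = T_n / n!, the averaging identity is the family
     sum_k C(i - k + j, j) P_(i-k+j) [P_k u, v] = [P_i u, P_j v].
   If P_n [P_k u, v] = 0 for all n > m, then the case j = m makes P_m commute
   with ad T_*(g), in particular with ad h, and the case (m + 1, m - 1) forces
   P_m x_b = 0 for all roots b.  Descending to m = 0, P_n kills the root vectors
   for n > 0, P_0 x_b = eta_b x_b, and the support of eta is the subsystem. *)
From HB Require Import structures.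
Require Import Defs.
From mathcomp Require Import boolp ring.

Set Implicit Arguments.
Unset Strict Implicit.
Unset Printing Implicit Defensive.

Import Order.TTheory GRing.Theory Num.Theory.
Local Open Scope ring_scope.

(** * Brackets and weights *)

(** The operators [T_n] with n > 0 need not vanish, since their restrictions to h_0^perp are
    arbitrary; what the descent bounds is therefore P_n [P_k u, v], to which h_0^perp contributes
    nothing. As h lies in the span of the vectors P_k u, an identity linear in P_k u passes to every
    t in h; this is how weights become available. In the case (m + 1, m - 1), with u = x_b and v in
    h, the terms k < m have index above m and the term k = m + 1 contains P_(m+1) x_b = 0. What
    survives is m P_m [P_m x_b, v], which is - m k^2 b(v) x_b when P_m x_b = k x_b; the factor m is
    why the descent ends at 0. Neither -D = D nor a(h_a) <> 0 is available before the Killing form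
    is understood, so the string lemmas carry them as hypotheses. A string through weight 0 meets h,
    which is not a line in general; its members are multiples of a and are treated apart. Positivity
    is real whereas the spans are complex; a conjugation on the span of the coroots bridges the
    two. *)

Section LieBasics.
Variables (F : fieldType) (g : lieAlgType F).
Implicit Types (u v w : g) (U V W I : {vspace g}).

HB.instance Definition _ u :=
  GRing.isLinear.Build F g g *:%R (lie u) (lie_linearr u).

Lemma lieC u v : lie u v = - lie v u.
Proof.
apply/eqP; rewrite -addr_eq0; apply/eqP.
by have := liexx (u + v); rewrite lieDl !lieDr !liexx addr0 add0r.
Qed.

Lemma lieNl u v : lie (- u) v = - lie u v.
Proof. by rewrite -scaleN1r lieZl scaleN1r. Qed.

Lemma lieNr u v : lie u (- v) = - lie u v.
Proof. by rewrite -scaleN1r lieZr scaleN1r. Qed.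

Lemma lie_leibniz u v w :
  lie u (lie v w) = lie (lie u v) w + lie v (lie u w).
Proof.
have /eqP := lie_jacobi u v w.
rewrite -addrA addr_eq0 => /eqP ->.
by rewrite opprD addrC (lieC w) opprK (lieC w u) lieNr opprK.
Qed.

Lemma span_prop_ind (P : g -> Prop) (s : seq g) :
  P 0 -> (forall u v, P u -> P v -> P (u + v)) ->
  (forall c u, P u -> P (c *: u)) ->
  (forall w, w \in s -> P w) -> forall v, v \in <<s>>%VS -> P v.
Proof.
move=> P0 PD PZ Ps v; rewrite -[s]/(val (in_tuple s)) => /coord_span->.
by elim/big_ind: _ => // i _; apply/PZ/Ps/mem_nth.
Qed.

(** The line through a central vector is an abelian ideal, hence zero. *)
Lemma semisimple_center U v : lie_semisimple U -> v \in U ->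
  (forall u, u \in U -> lie u v = 0) -> v = 0.
Proof.
move=> ssU Uv Cv; apply/eqP; rewrite -memv0 -(ssU <[v]>%VS).
- exact: memv_line.
- split; first by rewrite -memvE.
  apply/lie_prod_subP => u _ Uu /vlineP[k ->].
  by rewrite lieZr Cv // scaler0 mem0v.
exists 1%N; apply/eqP; rewrite /= -subv0; apply/lie_prod_subP.
move=> _ _ /vlineP[k ->] /vlineP[l ->].
by rewrite lieZl lieZr liexx !scaler0 mem0v.
Qed.

(* Subtracting from [s, \sum v_i] the multiple by the weight of the last v_i
   shortens the sum. *)
Lemma weights_separated (X : Type) (I : eqType) (r : seq I) (act : X -> g -> g)
    (chi : I -> X -> F) (v : I -> g) (V : {vspace g}) :
  (forall s, linear (act s)) ->
  (forall s w, w \in V -> act s w \in V) ->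
  (forall i s, i \in r -> act s (v i) = chi i s *: v i) ->
  (forall i j, i \in r -> j \in r -> i != j -> exists s, chi i s != chi j s) ->
  uniq r -> \sum_(i <- r) v i \in V -> forall i, i \in r -> v i \in V.
Proof.
move=> act_lin actV.
have actD s u w : act s (u + w) = act s u + act s w.
  by have := act_lin s 1 u w; rewrite !scale1r.
have act0 s : act s 0 = 0 by apply: (addrI (act s 0)); rewrite -actD !addr0.
have actZ s c u : act s (c *: u) = c *: act s u.
  by have := act_lin s c u 0; rewrite !addr0 act0 addr0.
elim: r v => // j r IHr v wt sep /= /andP[jr r_uniq].
rewrite big_cons => Vsum.
have wtr i s : i \in r -> act s (v i) = chi i s *: v i.
  by move=> ri; apply: wt; rewrite inE ri orbT.
have sepr i k : i \in r -> k \in r -> i != k -> exists s, chi i s != chi k s.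
  by move=> ri rk; apply: sep; rewrite inE ?ri ?rk orbT.
have Vr i : i \in r -> v i \in V.
  move=> ri; have [s nchi] : exists s, chi i s != chi j s.
    apply: sep; rewrite ?inE ?eqxx ?ri ?orbT //.
    by apply: contraNneq jr => <-.
  have : (chi i s - chi j s) *: v i \in V.
    apply: (IHr (fun k => (chi k s - chi j s) *: v k)) => //.
    - by move=> k t rk; rewrite actZ wtr // !scalerA mulrC.
    have -> : \sum_(k <- r) (chi k s - chi j s) *: v k =
        act s (v j + \sum_(k <- r) v k)
        - chi j s *: (v j + \sum_(k <- r) v k).
      rewrite actD wt ?mem_head // scalerDr opprD addrACA subrr add0r.
      rewrite (big_morph (act s) (actD s) (act0 s)) scaler_sumr -sumrB.
      by apply: eq_big_seq => k rk; rewrite wtr // scalerBl.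
    by rewrite memvB ?memvZ ?actV.
  by move/(memvZ (chi i s - chi j s)^-1); rewrite scalerK ?subr_eq0.
move=> i; rewrite inE => /predU1P[->|]; last exact: Vr.
rewrite -(addrK (\sum_(k <- r) v k) (v j)) memvB // big_seq.
exact: memv_suml.
Qed.

End LieBasics.

(* Engel's theorem for a Lie algebra whose weight spaces are lines, none of
   them of weight zero: [nz a b] says that the bracket of the root vectors of
   weights a and b is nonzero. *)
Section WeightEngel.
Variables (Z : zmodType) (B : seq Z) (nz : rel Z).
Hypothesis torsion_free : forall (c : Z) n, c != 0 -> c *+ n.+1 != 0.
Hypothesis B0 : 0 \notin B.
Hypothesis nzB : forall a b, a \in B -> b \in B -> nz a b -> a + b \in B.
Hypothesis nzC : forall a b, nz a b = nz b a.
Hypothesis nzxx : forall a, ~~ nz a a.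
(** The Leibniz rule read on supports: if the left side of [s, [c, v]] = [[s, c], v] + [c, [s, v]]
    is nonzero, so is one of the terms on the right. *)
Hypothesis nz_leibniz : forall s c v, s \in B -> c \in B -> v \in B ->
  nz c v -> nz s (c + v) ->
  (nz s c && nz (s + c) v) || (nz s v && nz c (s + v)).

(** A set of weights stands for the span of its root vectors. [stable S U] says that S maps the span
    of U to itself; [engel S], that every nonzero quotient V / U of stable spans contains the
    nonzero class of a root vector annihilated by S. *)
Let stable (S U : pred Z) := forall s u, S s -> U u -> nz s u -> U (s + u).

Let engel (S : pred Z) := forall U V : pred Z,
  (forall b, U b -> V b) -> (forall b, V b -> b \in B) ->
  stable S U -> stable S V -> (exists b, V b && ~~ U b) ->
  exists2 b, V b && ~~ U b & forall s, S s -> nz s b -> U (s + b).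

(** Without torsion the v + n c are pairwise distinct, so a finite set cannot contain them all. *)
Lemma leave_finite (W : seq Z) v c : c != 0 -> exists n, v + c *+ n \notin W.
Proof.
move=> c0; apply: contrapT => inW.
have {}inW n : v + c *+ n \in W by apply: contrapT => /negP H; apply: inW;
  exists n.
pose s := [seq v + c *+ i | i <- iota 0 (size W).+1].
have s_uniq : uniq s.
  rewrite map_inj_in_uniq ?iota_uniq // => i j _ _ /addrI cij.
  wlog lt_ij : i j cij / (i < j)%N.
    by case: (ltngtP i j) => // lt_ij => [H|H]; [|symmetry]; apply: H.
  have : c *+ (j - i.+1).+1 = 0.
    by rewrite -subSn // subSS mulrnBr ?(ltnW lt_ij) // cij subrr.
  by move/eqP; rewrite (negPf (torsion_free _ c0)).
have := uniq_leq_size s_uniq (s2 := W).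
rewrite size_map size_iota ltnn => H.
have : false by apply: H => _ /mapP[i _ ->].
by [].
Qed.

(** As c normalizes S, it preserves the vectors of V / U killed by S, by the Leibniz rule. The
    weights b, b + c, b + 2c, ... leave the finite set B, and the last one that is nonzero modulo U
    is killed by c as well. *)
Lemma engel_step (S S' : pred Z) c : (forall b, S b -> b \in B) -> c \in B ->
  stable S S -> (forall s, S s -> nz s c -> S (s + c)) ->
  (forall b, S' b = S b || (b == c)) -> engel S -> engel S'.
Proof.
move=> SB Bc SS Sc S'E eS U V UV VB SU SV exV.
have c0 : c != 0 by apply: contraNneq B0 => <-.
have SU1 : stable S U by move=> s u Ss; apply: SU; rewrite S'E Ss.
have SV1 : stable S V by move=> s u Ss; apply: SV; rewrite S'E Ss.
have [b /andP[Vb nUb] Sb] := eS U V UV VB SU1 SV1 exV.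
pose good v := [/\ V v, ~~ U v & forall s, S s -> nz s v -> U (s + v)].
have good_c v : good v -> nz c v -> ~~ U (c + v) -> good (c + v).
  case=> Vv nUv Sv nzcv nUcv; split=> //.
    by apply: SV => //; rewrite S'E eqxx orbT.
  move=> s Ss nzscv.
  case/orP: (nz_leibniz (SB _ Ss) Bc (VB _ Vv) nzcv nzscv).
    case/andP=> nzsc nzscv'; rewrite addrA; apply: Sv => //.
    exact: Sc.
  case/andP=> nzsv nzcsv; rewrite addrCA.
  apply: SU => //; first by rewrite S'E eqxx orbT.
  exact: Sv.
have [n nBn] := leave_finite B b c0.
have good_b : good b by split.
have [m [gm stop]] : exists m, good (b + c *+ m) /\
    (nz c (b + c *+ m) -> U (c + (b + c *+ m))).
  apply: contrapT => H.
  have {}H m : good (b + c *+ m) -> good (b + c *+ m.+1).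
    move=> gm; rewrite mulrS addrCA; apply: good_c => //.
      by apply: contrapT => K; apply: H; exists m; split=> // /K.
    by apply/negP => K; apply: H; exists m.
  have : good (b + c *+ n) by elim: n {nBn} => [|k IH];
    [rewrite addr0 | apply: H].
  by case=> /VB; rewrite (negPf nBn).
case: gm => Vm nUm Sm; exists (b + c *+ m); first by rewrite Vm.
by move=> s; rewrite S'E => /orP[Ss|/eqP->]; [apply: Sm | apply: stop].
Qed.

(** Sets S closed under brackets are enlarged one weight at a time: [engel S] on the quotient B / S
    yields a weight normalizing S. Once S is all of B, the quotient of B by 0 yields c. *)
Lemma weight_engel : (exists b, b \in B) ->
  exists2 c, c \in B & forall s, s \in B -> ~~ nz s c.
Proof.
move=> exB.
have main n : (n <= size B)%N -> exists S : seq Z,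
    [/\ uniq S, {subset S <= B}, (n <= size S)%N \/ {subset B <= S},
        stable (fun b => b \in S) (fun b => b \in S)
      & engel (fun b => b \in S)].
  elim: n => [_|n IHn ltn].
    exists [::]; split=> //; first by left.
    by move=> U V UV VB _ _ [b bUV]; exists b.
  have [S [uS SB big SS eS]] := IHn (ltnW ltn).
  have [sBS|nBS] := EM {subset B <= S}; first by exists S; split=> //; right.
  case: big => // lenS.
  have [||||b /andP[Bb nSb] Sb] :=
      eS (fun b => b \in S) (fun b => b \in B) SB => //.
  - by move=> s u /SB Bs; apply: nzB.
  - apply: contrapT => H; apply: nBS => b Bb; apply: contrapT => /negP nSb.
    by apply: H; exists b; apply/andP.
  exists (b :: S); split.
  - by rewrite /= nSb.
  - by move=> s; rewrite inE => /predU1P[->|/SB].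
  - by left.
  - move=> s u; rewrite !inE => /predU1P[->|Ss] /predU1P[->|Su] nzsu.
    + by rewrite (negPf (nzxx b)) in nzsu.
    + by rewrite addrC Sb ?orbT // nzC.
    + by rewrite Sb ?orbT.
    + by rewrite (SS s u) ?orbT.
  apply: (engel_step SB Bb SS Sb) eS => a.
  by rewrite inE orbC.
have [S [uS SB big SS eS]] := main _ (leqnn (size B)).
have BS : {subset B <= S}.
  by case: big => // lenS b; have [_ ->] := uniq_min_size uS SB lenS.
have [|||||c /andP[Bc _] Sc] := eS (fun _ => false) (fun b => b \in B) => //.
- by move=> s b /SB Bs; apply: nzB.
- by case: exB => b Bb; exists b; rewrite Bb.
by exists c => // s /BS Ss; apply/negP => /(Sc s Ss).
Qed.

End WeightEngel.

(** * The averaging identity *)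

Section Averaging.
Variables (F : fieldType) (g : lieAlgType F) (T : nat -> 'End(g)).
Implicit Types (u v w : g).

Lemma TpolyD u v n : Tpoly T (u + v) n = Tpoly T u n + Tpoly T v n.
Proof. by rewrite /Tpoly linearD scalerDr. Qed.

Lemma TpolyZ k u n : Tpoly T (k *: u) n = k *: Tpoly T u n.
Proof. by rewrite /Tpoly linearZ /= !scalerA mulrC. Qed.

Lemma Tpoly0 n : Tpoly T 0 n = 0.
Proof. by rewrite /Tpoly linear0 scaler0. Qed.

Lemma TpolyN u n : Tpoly T (- u) n = - Tpoly T u n.
Proof. by rewrite -scaleN1r TpolyZ scaleN1r. Qed.

(** [T_lambda u, v] is free of mu, so only the terms with b = 0 survive in [Tpoly2_ext]; k is the
    power of lambda taken by the inner operator. *)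
Lemma averagingP : averaging T <-> forall u v i j,
  \sum_(k < i.+1) 'C(i - k + j, i - k)%:R *:
      Tpoly T (lie (Tpoly T u k) v) (i - k + j)%N
    = lie (Tpoly T u i) (Tpoly T v j).
Proof.
have lhsE (P : nat -> g) v k l :
    lie2 (in_lambda P) (in_lambda (cpoly v)) k l =
      if l == 0%N then lie (P k) v else 0.
  rewrite /lie2 /in_lambda /cpoly big_ord_recr /= subnn eqxx.
  rewrite big1 => [|a _]; last first.
    rewrite big1 // => b _; case: (l - b)%N => [|?] /=; last by rewrite lie0r.
    by rewrite subn_eq0 leqNgt ltn_ord lie0r.
  rewrite add0r big_ord_recl /= subn0 big1 ?addr0 => [|b _].
    by case: eqP => // _; rewrite lie0r.
  by rewrite lie0l.
have rhsE (P Q : nat -> g) i j :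
    lie2 (in_lambda P) (in_mu Q) i j = lie (P i) (Q j).
  rewrite /lie2 /in_lambda /in_mu big_ord_recr /= subnn eqxx.
  rewrite big1 => [|a _]; last first.
    by rewrite big1 // => b _; rewrite subn_eq0 leqNgt ltn_ord lie0r.
  rewrite add0r big_ord_recl /= subn0 big1 ?addr0 // => b _.
  by rewrite lie0l.
have extE u v i j : Tpoly2_ext T (lie2 (in_lambda (Tpoly T u))
      (in_lambda (cpoly v))) i j =
    \sum_(k < i.+1) 'C(i - k + j, i - k)%:R *:
      Tpoly T (lie (Tpoly T u k) v) (i - k + j)%N.
  apply: eq_bigr => k _; rewrite big_ord_recl lhsE /= subn0 big1 ?addr0 //.
  by move=> l _; rewrite lhsE /= /Tpoly2 Tpoly0 scaler0.
by split=> H u v i j; have := H u v i j; rewrite extE rhsE.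
Qed.

Lemma Tstar_ind N (B : g -> Prop) (P : g -> Prop) :
  P 0 -> (forall u v, P u -> P v -> P (u + v)) ->
  (forall c u, P u -> P (c *: u)) ->
  (forall a b, B b -> P (Tval N T a b)) -> forall v, Tstar N T B v -> P v.
Proof.
move=> P0 PD PZ PT v [s sT sv]; apply: (span_prop_ind P0 PD PZ _ sv) => w.
by case/sT => a [b Bb ->]; apply: PT.
Qed.

Lemma Tstar0 N B : Tstar N T B 0.
Proof. by exists [::]; rewrite ?mem0v. Qed.

Lemma TstarD N B u v : Tstar N T B u -> Tstar N T B v -> Tstar N T B (u + v).
Proof.
move=> [s sB us] [r rB vr]; exists (s ++ r).
  by move=> w; rewrite mem_cat => /orP[/sB|/rB].
by rewrite span_cat memv_add.
Qed.

Lemma TstarZ N B c u : Tstar N T B u -> Tstar N T B (c *: u).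
Proof. by move=> [s sB us]; exists s => //; apply: memvZ. Qed.

Lemma Tstar_Tval N (B : g -> Prop) a b : B b -> Tstar N T B (Tval N T a b).
Proof.
move=> Bb; exists [:: Tval N T a b]; last exact: memv_span1.
by move=> w /[!inE]/eqP->; exists a; exists b.
Qed.

Lemma TvalD N a u v : Tval N T a (u + v) = Tval N T a u + Tval N T a v.
Proof.
by rewrite -big_split; apply: eq_bigr => n _; rewrite TpolyD scalerDr.
Qed.

Lemma TvalZ N a k u : Tval N T a (k *: u) = k *: Tval N T a u.
Proof.
rewrite scaler_sumr; apply: eq_bigr => n _.
by rewrite TpolyZ scalerA mulrC -scalerA.
Qed.

End Averaging.

(** * Linear maps with prescribed values *)

Section LinearExtension.
Variables (F : fieldType) (n : nat).

Definition lincomb (V : vectType F) (f : 'I_n -> V) (c : 'rV[F]_n) : V :=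
  \sum_i c 0 i *: f i.

Fact lincomb_linear (V : vectType F) (f : 'I_n -> V) : linear (lincomb f).
Proof.
move=> k c d; rewrite scaler_sumr -big_split; apply: eq_bigr => i _.
by rewrite !mxE scalerDl scalerA.
Qed.
HB.instance Definition _ (V : vectType F) (f : 'I_n -> V) :=
  GRing.isLinear.Build F 'rV[F]_n V *:%R (lincomb f) (lincomb_linear f).

(* A linear map may be prescribed on a family as long as it respects the
   linear relations. *)
Lemma lfun_from_relations (U V : vectType F) (f : 'I_n -> U) (e : 'I_n -> V) :
  (forall c : 'I_n -> F, \sum_i c i *: f i = 0 -> \sum_i c i *: e i = 0) ->
  exists phi : 'Hom(U, V), forall i, phi (f i) = e i.
Proof.
move=> rel; pose lf := linfun (lincomb f); pose le := linfun (lincomb e).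
have ker c : lf c = 0 -> le c = 0 by rewrite !lfunE; apply: rel.
have delta (W : vectType F) (d : 'I_n -> W) i : linfun (lincomb d) (delta_mx 0
  i) = d i.
  rewrite lfunE /= /lincomb (bigD1 i) //= mxE !eqxx scale1r big1 ?addr0 // => j
    ji.
  by rewrite mxE eqxx (negPf ji) scale0r.
(* [lf^-1] only picks some preimage of [f i] under [lf]; two preimages differ by a relation, which
   [le] kills. *)
exists (le \o lf^-1)%VF => i;
  rewrite comp_lfunE -{1}(delta _ f i) -(delta _ e i).
apply/eqP; rewrite -subr_eq0 -linearB; apply/eqP/ker.
by rewrite linearB /= limg_lfunVK ?memv_img ?memvf // subrr.
Qed.

End LinearExtension.

Lemma lfun_glue (F : fieldType) (V W : vectType F) (U1 U2 : {vspace V})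
    (f1 f2 : 'Hom(V, W)) : (U1 :&: U2 = 0)%VS ->
  exists f : 'Hom(V, W),
    (forall u, u \in U1 -> f u = f1 u) /\ (forall u, u \in U2 -> f u = f2 u).
Proof.
move=> cap0; have cap0' : (U2 :&: U1 = 0)%VS by rewrite capvC.
exists ((f1 \o daddv_pi U1 U2) + (f2 \o daddv_pi U2 U1))%VF.
have piC (V1 V2 : {vspace V}) u : (V1 :&: V2 = 0)%VS -> u \in V1 ->
    daddv_pi V2 V1 u = 0.
  move=> c0 Vu; have Vuu : u \in (V1 + V2)%VS by apply: subvP (addvSl _ _) _ Vu.
  have := daddv_pi_add c0 Vuu; rewrite daddv_pi_id // => /eqP.
  by rewrite -subr_eq0 addrC addKr => /eqP.
split=> u Uu; rewrite add_lfunE !comp_lfunE.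
  by rewrite (daddv_pi_id cap0) // (piC U1 U2) // linear0 addr0.
by rewrite (daddv_pi_id cap0') // (piC U2 U1) // linear0 add0r.
Qed.

(** * Root strings *)

Section RootTheory.
Variables (C : numClosedFieldType) (g : lieAlgType C) (h : {vspace g}).
Variables (D : seq (hdual h)) (x : hdual h -> g).
Implicit Types (a b c : hdual h) (t s u v w : g) (E : seq (hdual h)).

(** The value of a at a vector of g, meaningful for v in h. Through the projection it is linear on
    all of g, so additivity needs no membership proofs. *)
Definition ev a v : C := a (vsproj h v).

Lemma evD a u v : ev a (u + v) = ev a u + ev a v.
Proof. by rewrite /ev !linearD. Qed.
Lemma evZ a k v : ev a (k *: v) = k * ev a v.
Proof. by rewrite /ev !linearZ. Qed.
Lemma ev0 a : ev a 0 = 0.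
Proof. by rewrite /ev !linear0. Qed.
Lemma evN a v : ev a (- v) = - ev a v.
Proof. by rewrite /ev !linearN. Qed.
Lemma ev_sum a (I : Type) (r : seq I) (f : I -> g) :
  ev a (\sum_(i <- r) f i) = \sum_(i <- r) ev a (f i).
Proof. by rewrite /ev !linear_sum. Qed.
Lemma evDl a b v : ev (a + b) v = ev a v + ev b v.
Proof. by rewrite /ev add_lfunE. Qed.
Lemma evNl a v : ev (- a) v = - ev a v.
Proof. by rewrite /ev opp_lfunE. Qed.
Lemma ev0l v : ev 0 v = 0.
Proof. by rewrite /ev zero_lfunE. Qed.
Lemma evMnl a n v : ev (a *+ n) v = ev a v *+ n.
Proof. by elim: n => [|n IHn]; rewrite ?mulr0n ?ev0l // !mulrS evDl IHn. Qed.

Lemma ev_inj a b : (forall t, t \in h -> ev a t = ev b t) -> a = b.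
Proof.
move=> ab; apply/lfunP => t; have := ab (vsval t) (subvsP t).
by rewrite /ev vsvalK.
Qed.

Lemma ev_neq a b : a != b -> exists2 t, t \in h & ev a t != ev b t.
Proof.
move=> nab; apply: contrapT => H; move/eqP: nab; apply; apply: ev_inj => t ht.
by apply: contrapT => /eqP nt; apply: H; exists t.
Qed.

Lemma ev_neq0 a : a != 0 -> exists2 t, t \in h & ev a t != 0.
Proof. by move/ev_neq => [t ht]; rewrite ev0l; exists t. Qed.

Lemma hdual_torsion_free a n : a != 0 -> a *+ n.+1 != 0.
Proof.
case/ev_neq0=> t _ at0; apply/eqP => /(congr1 (fun b => ev b t)) /eqP.
by rewrite evMnl ev0l mulrn_eq0 (negPf at0).
Qed.

Lemma weight_vectorP a v :
  weight_vector a v <-> forall t, t \in h -> lie t v = ev a t *: v.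
Proof.
split=> [wv t ht|wv t]; last by rewrite wv ?subvsP // /ev vsvalK.
by have := wv (vsproj h t); rewrite vsprojK.
Qed.

Hypothesis g_semisimple : lie_semisimple {:g}%VS.
Hypothesis h_cartan : cartan h.
Hypothesis D_roots : root_system D.
Hypothesis gD : root_decomposition D x.

Let D_uniq : uniq D. Proof. by case: D_roots. Qed.

Lemma root_neq0 a : a \in D -> a != 0.
Proof. by case: D_roots => _ DP /DP[]. Qed.

Lemma root_vector_neq0 a : a \in D -> x a != 0.
Proof. by case: gD => xP _ _ /xP[]. Qed.

Lemma lie_h_root a t : t \in h -> a \in D -> lie t (x a) = ev a t *: x a.
Proof. by case: gD => xP _ _ ht /xP[_ /weight_vectorP->]. Qed.

Lemma weight_is_root a v : a != 0 -> v != 0 ->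
  (forall t, t \in h -> lie t v = ev a t *: v) -> a \in D.
Proof.
case: D_roots => _ DP a0 v0 wv; apply/DP; split=> //.
by exists v => //; apply/weight_vectorP.
Qed.

Definition root_basis : seq g := vbasis h ++ [seq x a | a <- D].

Lemma root_basisP : basis_of {:g}%VS root_basis.
Proof.
case: gD => xP gE dir; rewrite basisEdim; apply/andP; split.
  rewrite span_cat (span_basis (vbasisP h)) span_def big_map -gE.
  exact: subvv.
rewrite size_cat size_map size_tuple gE.
move: dir; rewrite directvE /= => /eqP ->; rewrite leq_add2l.
rewrite -sum1_size leq_eqVlt; apply/orP; left; apply/eqP.
by apply: eq_big_seq => a /xP[xa _]; rewrite dim_vline xa.
Qed.

Lemma span_map_uniq (T : eqType) (f : T -> g) (r : seq T) v : uniq r ->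
  v \in <<[seq f i | i <- r]>>%VS -> exists k : T -> C, v = \sum_(i <- r) k i
    *: f i.
Proof.
elim: r v => [v _|i r IHr v /= /andP[ir r_uniq]].
  by rewrite span_nil memv0 => /eqP->; exists (fun=> 0); rewrite big_nil.
rewrite span_cons => /memv_addP[_ /vlineP[k ->] [_ /(IHr _ r_uniq)[c ->] ->]].
exists (fun j => if j == i then k else c j).
rewrite big_cons eqxx; congr (_ + _); apply: eq_big_seq => j rj.
by case: eqP => // ji; rewrite -ji rj in ir.
Qed.

Lemma root_decP v : exists t (c : hdual h -> C),
  t \in h /\ v = t + \sum_(a <- D) c a *: x a.
Proof.
case: gD => _ gE _; have := memvf v; rewrite gE => /memv_addP[t ht [w Dw ->]].
have [|c ->] := @span_map_uniq _ x D w D_uniq;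
  first by rewrite span_def big_map.
by exists t, c.
Qed.

Lemma root_dec_eq0 t (c : hdual h -> C) : t \in h ->
  t + \sum_(a <- D) c a *: x a = 0 -> t = 0 /\ forall a, a \in D -> c a = 0.
Proof.
move=> ht tD0; have bfree := basis_free root_basisP.
move: (bfree); rewrite cat_free => /and3P[_ freeD dir].
have DV : \sum_(a <- D) c a *: x a \in <<[seq x a | a <- D]>>%VS.
  by rewrite big_seq; apply: memv_suml => a Da; apply/memvZ/memv_span/map_f.
have t0 : t = 0.
  apply/eqP; rewrite -memv0.
  have /eqP <- : (h :&: <<[seq x a | a <- D]>> == 0)%VS.
    rewrite -[X in (X :&: _)%VS](span_basis (vbasisP h)).
    exact/eqP/directv_addP.
  rewrite memv_cap ht /=.
  by move/eqP: tD0; rewrite addr_eq0 => /eqP ->; rewrite memvN.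
split=> // a Da; move: tD0; rewrite t0 add0r (big_nth 0) big_mkord => sum0.
have szD : size [seq x a | a <- D] == size D by rewrite size_map.
have /freeP free_x : free (Tuple szD) := freeD.
have iD : (index a D < size D)%N by rewrite index_mem.
have := free_x (fun i => c D`_i) _ (Ordinal iD); rewrite /= nth_index //.
apply; rewrite -[RHS]sum0; apply: eq_bigr => i _.
by rewrite /= (nth_map 0).
Qed.

Lemma sum_root1 a (f : hdual h -> C) : a \in D ->
  (forall b, b \in D -> b != a -> f b = 0) ->
  \sum_(b <- D) f b *: x b = f a *: x a.
Proof.
move=> Da f0; rewrite (bigD1_seq a) //= big_seq_cond big1 ?addr0 //.
by move=> b /andP[Db ba]; rewrite f0 ?scale0r.
Qed.

Lemma generic_ind (P : g -> Prop) :
  (forall u v, P u -> P v -> P (u + v)) -> (forall k u, P u -> P (k *: u)) ->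
  (forall t, t \in h -> P t) -> (forall a, a \in D -> P (x a)) ->
  forall v, P v.
Proof.
move=> PD PZ Ph Px v; have [t [c [ht ->]]] := root_decP v.
apply: (PD _ _ (Ph _ ht)); rewrite big_seq.
by elim/big_ind: _ => // [|a Da]; [apply/Ph/mem0v | apply/PZ/Px].
Qed.

Lemma cartan_center t : t \in h -> (forall s, s \in h -> lie s t = 0) ->
  (forall a, a \in D -> ev a t = 0) -> t = 0.
Proof.
move=> ht hC a0; apply: (semisimple_center g_semisimple (memvf _)) => u _.
elim/generic_ind: u => [u v|k u|s hs|a Da]; rewrite ?lieDl ?lieZl.
- by move=> -> ->; rewrite addr0.
- by move=> ->; rewrite scaler0.
- exact: hC.
by rewrite lieC lie_h_root // a0 // scale0r oppr0.
Qed.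

(** On the line of x_a both s and t act by scalars, so their bracket acts by zero. *)
Lemma ev_lie a s t : a \in D -> s \in h -> t \in h -> ev a (lie s t) = 0.
Proof.
move=> Da hs ht; have [subh _ _] := h_cartan.
have /eqP : lie (lie s t) (x a) = 0.
  have := lie_leibniz s t (x a).
  rewrite (lie_h_root hs Da) (lie_h_root ht Da) !lieZr.
  rewrite (lie_h_root hs Da) (lie_h_root ht Da) !scalerA mulrC => /eqP.
  by rewrite -subr_eq subrr eq_sym => /eqP.
rewrite lie_h_root ?subh // scaler_eq0 (negPf (root_vector_neq0 Da)) orbF.
by move/eqP.
Qed.

(* Each term of the lower central series of h after the first kills the root
   vectors, so the last nonzero one would be central in g. *)
Lemma cartan_abelian s t : s \in h -> t \in h -> lie s t = 0.
Proof.
move=> hs ht; have [subh [k hk] _] := h_cartan.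
have sub n : (iter n (lie_prod h) h <= h)%VS.
  elim: n => [|n IHn] /=; first exact: subvv.
  by apply/lie_prod_subP => u v hu /(subvP IHn) hv; apply: subh.
have main n : iter n.+1 (lie_prod h) h = 0%VS -> lie s t = 0.
  elim: n => [/= hh0|n IHn hn].
    by apply/eqP; rewrite -memv0 -hh0; apply: mem_lie_prod.
  apply: IHn; apply/eqP; rewrite -subv0; apply/subvP => v Vv.
  rewrite memv0; apply/eqP; apply: cartan_center.
  - exact: (subvP (sub n.+1)).
  - move=> u hu; apply/eqP; rewrite -memv0 -hn iterS.
    exact: mem_lie_prod.
  move=> a Da; elim/span_prop_ind: v / Vv => [|u v|c u|w].
  - by rewrite ev0.
  - by rewrite evD => -> ->; rewrite addr0.
  - by rewrite evZ => ->; rewrite mulr0.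
  case/allpairsP=> [[u v] [/= /vbasis_mem hu /vbasis_mem Vv ->]].
  apply: ev_lie => //; exact: (subvP (sub n)).
apply: (main k); apply/eqP; rewrite -subv0 /= hk.
by apply/lie_prod_subP => u v _; rewrite !memv0 => /eqP->; rewrite lie0r.
Qed.

Lemma h_bracket t s (c : hdual h -> C) : t \in h -> s \in h ->
  lie s (t + \sum_(a <- D) c a *: x a) = \sum_(a <- D) (ev a s * c a) *: x a.
Proof.
move=> ht hs; rewrite lieDr cartan_abelian // add0r lie_sumr.
by apply: eq_big_seq => a Da; rewrite lieZr lie_h_root // scalerA mulrC.
Qed.

Lemma weight_coef b v t (c : hdual h -> C) : t \in h ->
  v = t + \sum_(a <- D) c a *: x a ->
  (forall s, s \in h -> lie s v = ev b s *: v) ->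
  (b != 0 -> t = 0) /\ forall a, a \in D -> a != b -> c a = 0.
Proof.
move=> ht -> wv.
have wc s : s \in h -> ev b s *: t = 0 /\
    forall a, a \in D -> (ev b s - ev a s) * c a = 0.
  move=> hs; apply: root_dec_eq0; first exact: memvZ.
  under eq_bigr do rewrite mulrBl scalerBl.
  rewrite sumrB addrA -(h_bracket c ht hs) wv // scalerDr scaler_sumr.
  by under eq_bigr do rewrite -scalerA; rewrite subrr.
split=> [/ev_neq0[s hs bs]|a Da /ev_neq[s hs nab]].
  by have [/eqP + _] := wc s hs; rewrite scaler_eq0 (negPf bs) => /eqP.
have [_ /(_ a Da)/eqP] := wc s hs.
by rewrite mulf_eq0 subr_eq0 eq_sym (negPf nab) => /eqP.
Qed.

(* The weight spaces of nonzero weight are the lines of the x a. *)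
Lemma weight_line a v : a \in D ->
  (forall t, t \in h -> lie t v = ev a t *: v) -> exists k, v = k *: x a.
Proof.
move=> Da wv; have [t [c [ht vE]]] := root_decP v.
have [/(_ (root_neq0 Da)) t0 c0] := weight_coef ht vE wv.
by exists (c a); rewrite vE t0 add0r (sum_root1 Da).
Qed.

Lemma weight_not_root a v : a != 0 -> a \notin D ->
  (forall t, t \in h -> lie t v = ev a t *: v) -> v = 0.
Proof.
move=> a0 nDa wv; apply: contrapT => /eqP v0.
by rewrite (weight_is_root a0 v0 wv) in nDa.
Qed.

(** With commutativity this makes h its own centralizer: a vector of weight zero has no component
    along a root. *)
Lemma weight0_in_h v : (forall t, t \in h -> lie t v = 0) -> v \in h.
Proof.
move=> wv; have [t [c [ht vE]]] := root_decP v.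
have [|_ c0] := @weight_coef 0 _ _ _ ht vE.
  by move=> s hs; rewrite wv // ev0l scale0r.
rewrite vE big_seq big1 ?addr0 // => a Da.
by rewrite c0 ?scale0r // root_neq0.
Qed.

Lemma lie_weight a b u v :
  (forall t, t \in h -> lie t u = ev a t *: u) ->
  (forall t, t \in h -> lie t v = ev b t *: v) ->
  forall t, t \in h -> lie t (lie u v) = ev (a + b) t *: lie u v.
Proof.
move=> wu wv t ht; rewrite lie_leibniz (wu t ht) (wv t ht) lieZl lieZr
  -scalerDl.
by rewrite evDl.
Qed.

Lemma lie_root_weight a b t : a \in D -> b \in D -> t \in h ->
  lie t (lie (x a) (x b)) = ev (a + b) t *: lie (x a) (x b).
Proof. by move=> Da Db; apply: lie_weight => s hs; apply: lie_h_root. Qed.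

Lemma lie_roots_notin a b : a \in D -> b \in D -> a + b != 0 ->
  a + b \notin D -> lie (x a) (x b) = 0.
Proof.
move=> Da Db ab0 nab; apply: (weight_not_root ab0 nab) => t.
exact: lie_root_weight.
Qed.

Lemma lie_roots_line a b : a \in D -> b \in D -> a + b \in D ->
  exists k, lie (x a) (x b) = k *: x (a + b).
Proof. by move=> Da Db Dab; apply: weight_line => // t;
  apply: lie_root_weight. Qed.

Lemma coroot_in_h a : a \in D -> - a \in D -> coroot x a \in h.
Proof.
move=> Da DNa; apply: weight0_in_h => t ht.
by rewrite /coroot lie_root_weight // subrr ev0l scale0r.
Qed.

Lemma lie_corootE a b : a \in D -> - a \in D -> b \in D ->
  lie (coroot x a) (x b) = ev b (coroot x a) *: x b.
Proof. by move=> Da DNa Db; rewrite lie_h_root // coroot_in_h. Qed.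

Lemma coroot_opp a : coroot x (- a) = - coroot x a.
Proof. by rewrite /coroot opprK lieC. Qed.

(** Used to climb a string: exchanging x_a and x_(-a) costs the value of c at the coroot, and
    [string_shift] then carries the scalar over to the next root. *)
Lemma string_step a c m : a \in D -> - a \in D -> c \in D ->
  lie (x a) (lie (x (- a)) (x c)) = m *: x c ->
  lie (x (- a)) (lie (x a) (x c)) = (m - ev c (coroot x a)) *: x c.
Proof.
move=> Da DNa Dc; rewrite lie_leibniz -/(coroot x a) lie_corootE //.
by rewrite addrC => /(canRL (addrK _)) ->; rewrite scalerBl.
Qed.

(** If [x_a, x_c] = k x_(c+a) and [x_(-a), x_(c+a)] = l x_c, both composites are the scalar k l. *)
Lemma string_shift a c n : a \in D -> - a \in D -> c \in D -> c + a \in D ->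
  lie (x (- a)) (lie (x a) (x c)) = n *: x c ->
  lie (x a) (lie (x (- a)) (x (c + a))) = n *: x (c + a).
Proof.
move=> Da DNa Dc Dca; have Dac : a + c \in D by rewrite addrC.
have [k kE] := lie_roots_line Da Dc Dac.
have [|l] := lie_roots_line DNa Dac; first by rewrite addKr.
rewrite addKr [a + c]addrC => lE;
  rewrite kE [a + c]addrC lieZr lE scalerA => /eqP.
rewrite -subr_eq0 -scalerBl scaler_eq0 (negPf (root_vector_neq0 Dc)) orbF.
rewrite subr_eq0 => /eqP <-.
by rewrite lieZr kE scalerA mulrC addrC.
Qed.

(* The coefficients telescope along the a-string which starts at c. *)
Lemma string_telescope a c j : a \in D -> - a \in D ->
  lie (x a) (lie (x (- a)) (x c)) = 0 ->
  (forall k, (k <= j)%N -> c + a *+ k \in D) ->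
  lie (x (- a)) (lie (x a) (x (c + a *+ j))) =
    (- (j.+1%:R * (ev c (coroot x a) + j%:R / 2%:R * ev a (coroot x a))))
      *: x (c + a *+ j).
Proof.
(* The scalar is minus the sum of (c + i a)(h_a) for i <= j, an arithmetic progression. *)
move=> Da DNa low; elim: j => [|j IHj] Dj.
  have Dc := Dj 0%N isT; rewrite mulr0n addr0 in Dc *.
  have := @string_step a c 0 Da DNa Dc; rewrite scale0r => -> //.
  by congr (_ *: _); field.
have Dcj := Dj j (leqnSn j); have := Dj j.+1 (leqnn _).
rewrite mulrSr addrA => DcSj.
have {}IHj := IHj (fun k jk => Dj k (leqW jk)).
rewrite (string_step Da DNa DcSj (string_shift Da DNa Dcj DcSj IHj)).
congr (_ *: _); rewrite !evDl evMnl -mulr_natr -!natr1.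
by field.
Qed.

Lemma string_end a b : a != 0 -> b \in D ->
  exists p, (forall k, (k <= p)%N -> b + a *+ k \in D) /\ b + a *+ p.+1 \notin
    D.
Proof.
move=> a0 Db; have ex := leave_finite hdual_torsion_free D b a0.
case: (ex_minnP ex) => -[|p]; first by rewrite mulr0n addr0 Db.
move=> nD minp; exists p; split=> // k kp; apply: contrapT => /negP /minp.
by rewrite ltnNge kp.
Qed.

(** At the top of the string the telescoped scalar vanishes: h_a has trace zero on the string, so
    its values are symmetric about the midpoint. *)
Lemma string_top0 a c j : a \in D -> - a \in D ->
  lie (x a) (lie (x (- a)) (x c)) = 0 ->
  (forall k, (k <= j)%N -> c + a *+ k \in D) ->
  lie (x a) (x (c + a *+ j)) = 0 ->
  ev c (coroot x a) = - (j%:R / 2%:R * ev a (coroot x a)).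
Proof.
move=> Da DNa low Dj top.
have /eqP := string_telescope Da DNa low Dj; rewrite top lie0r eq_sym.
rewrite scaler_eq0 (negPf (root_vector_neq0 (Dj j (leqnn j)))) orbF oppr_eq0.
by rewrite mulf_eq0 pnatr_eq0 /= addr_eq0 => /eqP.
Qed.

Lemma string_top_next a b j : a \in D -> b + a *+ j \in D ->
  b + a *+ j.+1 \notin D -> b + a *+ j.+1 != 0 ->
  lie (x a) (x (b + a *+ j)) = 0.
Proof.
rewrite mulrSr addrA [_ + a]addrC => Da Dj nD n0.
exact: lie_roots_notin.
Qed.

Lemma coroot_ratio a b : a \in D -> - a \in D -> b \in D ->
  exists2 r : C, r \is Num.real & ev b (coroot x a) = r * ev a (coroot x a).
Proof.
move=> Da DNa Db; have a0 := root_neq0 Da.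
have [|p [Dp nDp]] := @string_end (- a) b _ Db; first by rewrite oppr_eq0.
set c := b + - a *+ p; have Dc : c \in D by apply: Dp.
have bE : b = c + a *+ p by rewrite /c mulNrn subrK.
have cE : b + - a *+ p.+1 = c - a by rewrite mulrSr addrA.
clearbody c.
have evb : ev b (coroot x a) = ev c (coroot x a) + p%:R * ev a (coroot x a).
  by rewrite bE evDl evMnl mulr_natl.
have [ca|ca] := eqVneq (c - a) 0.
  exists (1 + p%:R); first by rewrite rpredD ?rpred1 ?rpred_nat.
  have {}ca : c = a by apply/eqP; rewrite -subr_eq0 ca.
  by rewrite evb ca mulrDl mul1r.
have [q [Dq nDq]] := string_end a0 Dc.
have [cq|cq] := eqVneq (c + a *+ q.+1) 0.
  exists (p%:R - q.+1%:R); first by rewrite rpredB ?rpred_nat.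
  have {}cq : c = - (a *+ q.+1) by apply/eqP; rewrite -addr_eq0 cq.
  by rewrite evb cq evNl evMnl -(mulr_natl (ev a _)); ring.
have low : lie (x a) (lie (x (- a)) (x c)) = 0.
  by rewrite (lie_roots_notin DNa Dc) ?lie0r // addrC ?ca // -cE.
exists (p%:R - q%:R / 2%:R); first by rewrite rpredB ?rpred_div ?rpred_nat.
rewrite evb (string_top0 Da DNa low Dq (string_top_next Da (Dq _ (leqnn q)) nDq
  cq)).
by ring.
Qed.

(** On the least root of the form (m + 2) a, x_(-a) gives 0 or, when m = 0, a multiple of x_a, which
    x_a kills. So [string_top0] would yield m + 2 + q / 2 = 0. *)
Lemma root_multiple a k : a \in D -> - a \in D -> ev a (coroot x a) != 0 ->
  a *+ k.+2 \notin D.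
Proof.
move=> Da DNa ah; apply/negP => Dk.
have ex : exists m, a *+ m.+2 \in D by exists k.
case: (ex_minnP ex) => m Dm minm.
have low : lie (x a) (lie (x (- a)) (x (a *+ m.+2))) = 0.
  have aE : - a + a *+ m.+2 = a *+ m.+1 by rewrite mulrS addKr.
  have a0 : a *+ m.+1 != 0 by apply/hdual_torsion_free/root_neq0.
  have [Dm1|nDm1] := boolP (a *+ m.+1 \in D).
    have [|l ->] := lie_roots_line DNa Dm; first by rewrite aE.
    case: m minm {Dm a0} aE Dm1 => [|m] minm aE Dm1.
      by rewrite aE mulr1n lieZr liexx scaler0.
    by have := minm m Dm1; rewrite ltnn.
  by rewrite (lie_roots_notin DNa Dm) ?lie0r // aE.
have [q [Dq nDq]] := string_end (root_neq0 Da) Dm.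
have n0 : a *+ m.+2 + a *+ q.+1 != 0.
  by rewrite -mulrnDr addSn; apply/hdual_torsion_free/root_neq0.
have := string_top0 Da DNa low Dq (string_top_next Da (Dq _ (leqnn q)) nDq n0).
move/eqP; rewrite evMnl -(mulr_natl (ev a _)) -addr_eq0 -mulrDl mulf_eq0 (negPf
  ah) orbF.
apply/negP; rewrite gt_eqF // ltr_wpDr ?ltr0n // divr_ge0 ?ler0n //.
Qed.

(* Otherwise the part of the a-string up to b and the part from a + b on
   would both be centred at a zero of the coroot. *)
Lemma lie_roots_neq0 a b : a \in D -> - a \in D -> ev a (coroot x a) != 0 ->
  b \in D -> a + b \in D -> lie (x a) (x b) != 0.
Proof.
move=> Da DNa ah Db Dab; apply/eqP => ab0; have a0 := root_neq0 Da.
have [|p [Dp nDp]] := @string_end (- a) b _ Db; first by rewrite oppr_eq0.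
set c := b + - a *+ p; have Dc : c \in D by apply: Dp.
have bE : b = c + a *+ p by rewrite /c mulNrn subrK.
have cE : b + - a *+ p.+1 = c - a by rewrite mulrSr addrA.
clearbody c.
have ca : c - a != 0.
  apply/eqP => ca; have {}ca : c = a by apply/eqP; rewrite -subr_eq0 ca.
  have aE : a + b = a *+ p.+2 by rewrite bE ca !mulrS.
  by move: Dab; rewrite aE (negPf (root_multiple _ _ _ _)).
have low : lie (x a) (lie (x (- a)) (x c)) = 0.
  by rewrite (lie_roots_notin DNa Dc) ?lie0r // addrC ?ca // -cE.
have Dcp k : (k <= p)%N -> c + a *+ k \in D.
  move=> kp; suff -> : c + a *+ k = b + - a *+ (p - k) by apply/Dp/leq_subr.
  have aE : a *+ p = a *+ k + a *+ (p - k) by rewrite -mulrnDr subnKC.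
  by rewrite bE aE mulNrn addrA addrK.
have ch := string_top0 Da DNa low Dcp; rewrite -bE in ch; have {}ch := ch ab0.
have [q [Dq nDq]] := string_end a0 Dab.
have n0 : a + b + a *+ q.+1 != 0.
  apply/eqP => H; have bE' : b = (- a) *+ q.+2.
    by apply/eqP; rewrite mulNrn -addr_eq0 mulrS addrCA addrA H.
  move: Db; rewrite bE' (negPf (root_multiple _ _ _ _)) ?opprK //.
  by rewrite evNl coroot_opp evN opprK.
have low' : lie (x a) (lie (x (- a)) (x (a + b))) = 0.
  have [|l ->] := lie_roots_line DNa Dab; first by rewrite addKr.
  by rewrite addKr lieZr ab0 scaler0.
have := string_top0 Da DNa low' Dq (string_top_next Da (Dq _ (leqnn q)) nDq n0).
move/eqP; rewrite bE !evDl evMnl -(mulr_natl (ev a _)) ch -subr_eq0.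
set A := ev a _ in ah *.
(* The two centres are b - (p / 2) a and a + b + (q / 2) a; they differ by this positive multiple of
   a. *)
have -> : A + (- (p%:R / 2%:R * A) + p%:R * A) - - (q%:R / 2%:R * A)
   = (1 + p%:R / 2%:R + q%:R / 2%:R) * A by field.
rewrite mulf_eq0 (negPf ah) orbF; apply/negP; rewrite gt_eqF //.
by rewrite !ltr_wpDr ?divr_ge0 ?ler0n ?ltr01.
Qed.

(** * The Killing form *)

Definition killing u v : C :=
  \sum_(i < size root_basis)
    coord (in_tuple root_basis) i (lie u (lie v root_basis`_i)).

Lemma trace_cyclic (f1 f2 : {linear g -> g}) :
  \sum_(i < size root_basis)
    coord (in_tuple root_basis) i (f1 (f2 root_basis`_i)) =
  \sum_(i < size root_basis)
    coord (in_tuple root_basis) i (f2 (f1 root_basis`_i)).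
Proof.
have expand (e1 e2 : {linear g -> g}) (i : 'I_(size root_basis)) :
    coord (in_tuple root_basis) i (e1 (e2 root_basis`_i)) =
    \sum_(j < size root_basis) coord (in_tuple root_basis) j (e2 root_basis`_i)
      * coord (in_tuple root_basis) i (e1 root_basis`_j).
  have bg : basis_of {:g}%VS (in_tuple root_basis) := root_basisP.
  rewrite {1}(coord_basis bg (memvf (e2 root_basis`_i))) !linear_sum.
  by apply: eq_bigr => j _; rewrite !linearZ.
under eq_bigr do rewrite expand; rewrite exchange_big /=.
by apply: eq_bigr => i _; rewrite expand; apply: eq_bigr => j _; rewrite mulrC.
Qed.

Lemma killingDl u v w : killing (u + v) w = killing u w + killing v w.
Proof. by rewrite -big_split; apply: eq_bigr => i _; rewrite lieDl linearD. Qed.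
Lemma killingZl k u v : killing (k *: u) v = k * killing u v.
Proof. by rewrite mulr_sumr; apply: eq_bigr => i _; rewrite lieZl linearZ. Qed.
Lemma killingC u v : killing u v = killing v u.
Proof. exact: (trace_cyclic (lie u) (lie v)). Qed.
Lemma killingDr u v w : killing w (u + v) = killing w u + killing w v.
Proof. by rewrite !(killingC w) killingDl. Qed.
Lemma killingZr k u v : killing v (k *: u) = k * killing v u.
Proof. by rewrite !(killingC v) killingZl. Qed.
Lemma killingNl u v : killing (- u) v = - killing u v.
Proof. by rewrite -scaleN1r killingZl mulN1r. Qed.
Lemma killingNr u v : killing v (- u) = - killing v u.
Proof. by rewrite !(killingC v) killingNl. Qed.
Lemma killing0l u : killing 0 u = 0.
Proof. by rewrite -(scale0r 0) killingZl mul0r. Qed.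
Lemma killing0r u : killing u 0 = 0.
Proof. by rewrite killingC killing0l. Qed.
Lemma killing_suml (I : Type) (r : seq I) (f : I -> g) v :
  killing (\sum_(i <- r) f i) v = \sum_(i <- r) killing (f i) v.
Proof.
exact: (big_morph (killing^~ v) (fun u w => killingDl u w v) (killing0l v)).
Qed.

(** Both sides expand into two traces of triple products of ad u, ad v, ad w, which agree up to
    cyclic permutation. *)
Lemma killing_inv u v w : killing (lie u v) w = killing u (lie v w).
Proof.
have kE u1 u2 u3 : killing (lie u1 u2) u3 = \sum_(i < size root_basis)
    coord (in_tuple root_basis) i (lie u1 (lie u2 (lie u3 root_basis`_i))) -
  \sum_(i < size root_basis)
    coord (in_tuple root_basis) i (lie u2 (lie u1 (lie u3 root_basis`_i))).
  rewrite -sumrB; apply: eq_bigr => i _; rewrite -linearB; congr (coord _ _ _).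
  by rewrite [lie u1 (lie u2 _)]lie_leibniz addrK.
rewrite [RHS]killingC !kE; congr (_ - _).
  exact: (trace_cyclic (lie u) (lie v \o lie w)).
exact: (trace_cyclic (lie v \o lie u) (lie w)).
Qed.

Lemma killing_h s t : s \in h -> t \in h ->
  killing s t = \sum_(a <- D) ev a s * ev a t.
Proof.
move=> hs ht; have bfree := basis_free root_basisP.
(* The eigenvalues of ad s ad t on the root basis: 0 on h, then a(s) a(t) on each x_a. *)
pose e := nseq (\dim h) 0 ++ [seq ev a s * ev a t | a <- D].
have sz_e : size e = size root_basis.
  by rewrite !size_cat size_nseq !size_map size_tuple.
transitivity (\sum_(i < size root_basis) e`_i).
  apply: eq_bigr => i _; suff -> : lie s (lie t root_basis`_i) =
      e`_i *: (in_tuple root_basis)`_i.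
    by rewrite linearZ /= coord_free // eqxx mulr1.
  rewrite /= /root_basis /e !nth_cat size_nseq size_tuple.
  case: ltnP => [ilt|ige].
    rewrite nth_nseq ilt (@cartan_abelian t) ?lie0r ?scale0r //.
    by apply/vbasis_mem/mem_nth; rewrite size_tuple.
  have ilt : (i - \dim h < size D)%N.
    by rewrite ltn_subLR // -(size_map x) -{1}(size_tuple (vbasis h)) -size_cat.
  rewrite !(nth_map 0) // (lie_h_root ht) ?mem_nth // lieZr.
  by rewrite (lie_h_root hs) ?mem_nth // scalerA mulrC.
rewrite -sz_e -(big_mkord xpredT (fun i => e`_i)) -(big_nth 0 xpredT id)
  big_cat big_map /=.
by rewrite big_nseq iter_addr_0 mul0rn add0r.
Qed.

Lemma killing_root_h a v : a \in D -> v \in h -> killing (x a) v = 0.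
Proof.
move=> Da hv; have [t ht at0] := ev_neq0 (root_neq0 Da).
apply: (mulfI at0); rewrite mulr0 -killingZl -lie_h_root // lieC killingNl.
by rewrite killing_inv cartan_abelian // killing0r oppr0.
Qed.

Lemma killing_roots a b : a \in D -> b \in D -> a + b != 0 ->
  killing (x a) (x b) = 0.
Proof.
move=> Da Db /ev_neq0[t ht abt].
apply: (mulfI abt); rewrite mulr0 evDl mulrDl -killingZl -killingZr.
by rewrite -!lie_h_root // lieC killingNl killing_inv addNr.
Qed.

Lemma killing_root_eq0 a : a \in D ->
  (- a \in D -> killing (x a) (x (- a)) = 0) -> forall v, killing (x a) v = 0.
Proof.
move=> Da k0 v; elim/generic_ind: v => [u v Hu Hv|k u Hu|t ht|b Db].
- by rewrite killingDr Hu Hv addr0.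
- by rewrite killingZr Hu mulr0.
- exact: killing_root_h.
have [/eqP|ab0] := eqVneq (a + b) 0; last exact: killing_roots.
by rewrite addr_eq0 -eqr_oppLR => /eqP bE; move: Db; rewrite -bE.
Qed.

(** Up to the last factor, the coroot represents a through the Killing form. *)
Lemma killing_coroot a t : a \in D -> - a \in D -> t \in h ->
  killing (coroot x a) t = ev a t * killing (x a) (x (- a)).
Proof.
move=> Da DNa ht; rewrite killing_inv lieC killingNr lie_h_root //.
by rewrite killingZr evNl mulNr opprK.
Qed.

(* The Killing form is positive definite on the rational span of the coroots. *)
Lemma coroot_isotropic a : a \in D -> - a \in D ->
  killing (coroot x a) (coroot x a) = 0 -> coroot x a = 0.
Proof.
move=> Da DNa; have hh := coroot_in_h Da DNa; rewrite killing_h // => k0.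
have sq0 b : b \in D -> ev b (coroot x a) = 0.
  have [ah0|ah0] := eqVneq (ev a (coroot x a)) 0.
    by case/(coroot_ratio Da DNa) => r _ ->; rewrite ah0 mulr0.
  (* Dividing by a(h_a) makes every term the square of a real number, while the term c = a is 1. *)
  have : \sum_(c <- D) (ev c (coroot x a) / ev a (coroot x a)) ^+ 2 = 0.
    transitivity ((\sum_(c <- D) ev c (coroot x a) * ev c (coroot x a))
        / ev a (coroot x a) ^+ 2); last by rewrite k0 mul0r.
    by rewrite mulr_suml; apply: eq_bigr => c _; rewrite expr_div_n !expr2.
  move/eqP; rewrite big_seq psumr_eq0; last first.
    move=> c Dc; have [r r_real ->] := coroot_ratio Da DNa Dc.
    by rewrite mulfK // real_exprn_even_ge0.
  move/allP/(_ a Da); rewrite Da divff // expr1n oner_eq0.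
  by [].
apply: cartan_center => // s hs; exact: cartan_abelian.
Qed.

(** The radical is an ideal. If a + b = 0, the bracket is a coroot lying in the radical, hence
    isotropic, hence 0. *)
Lemma radical_bracket a b : a \in D -> (forall v, killing (x a) v = 0) ->
  b \in D -> lie (x b) (x a) = 0 \/
  [/\ b + a \in D, forall v, killing (x (b + a)) v = 0
    & exists k, lie (x b) (x a) = k *: x (b + a)].
Proof.
move=> Da Ka Db; have Kab v : killing (lie (x b) (x a)) v = 0.
  by rewrite lieC killingNl killing_inv Ka oppr0.
have [ab0|ab0] := eqVneq (b + a) 0.
  have bE : b = - a by apply/eqP; rewrite -addr_eq0 ab0.
  left; have DNb : - b \in D by rewrite bE opprK.
  suff : coroot x b = 0 by rewrite /coroot bE opprK.
  by apply: coroot_isotropic => //; rewrite /coroot bE opprK -bE Kab.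
have [Dba|nDba] := boolP (b + a \in D); last by left; apply: lie_roots_notin.
have [k kE] := lie_roots_line Db Da Dba.
have [k0|k0] := eqVneq k 0; first by left; rewrite kE k0 scale0r.
right; split=> //; last by exists k.
by move=> v; apply: (mulfI k0); rewrite -killingZl -kE Kab mulr0.
Qed.

Lemma killing_root_neq0 a : a \in D -> ~ forall v, killing (x a) v = 0.
Proof.
move=> Da Ka.
pose B := [seq b <- D | `[< forall v, killing (x b) v = 0 >]].
have BP b : reflect (b \in D /\ forall v, killing (x b) v = 0) (b \in B).
  by rewrite mem_filter andbC; apply: (iffP andP) => -[? /asboolP].
have nzB b c : c \in B -> b \in D -> lie (x b) (x c) != 0 ->
    b + c \in B /\ exists2 k, k != 0 & lie (x b) (x c) = k *: x (b + c).
  move=> /BP[Dc Kc] Db; have [->|[Dbc Kbc [k kE]]] := radical_bracket Dc Kc Db.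
    by rewrite eqxx.
  rewrite kE scaler_eq0 negb_or => /andP[k0 _]; split; last by exists k.
  exact/BP.
have BD b : b \in B -> b \in D by case/BP.
have [|b c Bb Bc nz|b c|b|s c v Bs Bc Bv nzcv nzscv||c Bc cent] :=
    @weight_engel _ B (fun b c => lie (x b) (x c) != 0) hdual_torsion_free.
- by apply/negP => /BD /root_neq0; rewrite eqxx.
- by have [] := nzB _ _ Bc (BD _ Bb) nz.
- by rewrite lieC oppr_eq0.
- by rewrite liexx eqxx.
- have [Bcv [k k0 kE]] := nzB _ _ Bv (BD _ Bc) nzcv.
  have : lie (x s) (lie (x c) (x v)) != 0.
    by rewrite kE lieZr scaler_eq0 negb_or k0.
  rewrite lie_leibniz; apply: contraNT; rewrite negb_or !negb_and !negbK.
  case/andP=> H1 H2; apply/eqP; rewrite -[RHS]addr0; congr (_ + _).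
    have [->|nz] := eqVneq (lie (x s) (x c)) 0; first by rewrite lie0l.
    have [_ [l l0 lE]] := nzB _ _ Bc (BD _ Bs) nz.
    move: H1; rewrite (negPf nz) /= => /eqP H1.
    by rewrite lE lieZl H1 scaler0.
  have [->|nz] := eqVneq (lie (x s) (x v)) 0; first by rewrite lie0r.
  have [_ [l l0 lE]] := nzB _ _ Bv (BD _ Bs) nz.
  move: H2; rewrite (negPf nz) /= => /eqP H2.
  by rewrite lE lieZr H2 scaler0.
- by exists a; apply/BP.
(* [Z] gives the centre of the ideal spanned by the root vectors in the radical; the centre of an
   ideal is again an ideal, and it is abelian. *)
pose Z := [seq b <- B | all (fun d => lie (x d) (x b) == 0) B].
have ZP b : reflect (b \in B /\ forall d, d \in B -> lie (x d) (x b) = 0)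
    (b \in Z).
  rewrite [b \in Z]mem_filter; apply: (iffP andP) => [[Hb Bb]|[Bb Hb]];
    split=> //.
    by move=> d Bd; apply/eqP; move/allP: Hb; apply.
  by apply/allP => d Bd; apply/eqP/Hb.
have Zc : c \in Z by apply/ZP; split=> // d Bd; apply/eqP/negPn/cent.
have : <<[seq x b | b <- Z]>>%VS = 0%VS.
  apply: g_semisimple; last exists 1%N.
    split; first exact: subvf.
    apply/lie_prod_subP => u v _ Zv; elim/span_prop_ind: v / Zv => [|v w|k v|w].
    - by rewrite lie0r mem0v.
    - by rewrite lieDr; apply: memvD.
    - by rewrite lieZr; apply: memvZ.
    case/mapP => b /ZP[Bb bC ->] {w};
      elim/generic_ind: u => [v w|k v|t ht|d Dd].
    - by rewrite lieDl; apply: memvD.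
    - by rewrite lieZl; apply: memvZ.
    - by rewrite lie_h_root ?BD // memvZ ?memv_span ?map_f //; apply/ZP.
    have [->|nz] := eqVneq (lie (x d) (x b)) 0; first exact: mem0v.
    have [Bdb [k k0 kE]] := nzB _ _ Bb Dd nz.
    rewrite kE memvZ ?memv_span ?map_f //; apply/ZP; split=> // s Bs.
    apply: (scalerI k0); rewrite -lieZr -kE scaler0 lie_leibniz bC // lie0r
      addr0.
    have [|nz'] := eqVneq (lie (x s) (x d)) 0; first by move->; rewrite lie0l.
    have nz2 : lie (x d) (x s) != 0 by rewrite lieC oppr_eq0.
    have [Bds [l l0 lE]] := nzB _ _ Bs Dd nz2.
    by rewrite (lieC (x s)) lE lieNl lieZl bC // scaler0 oppr0.
  apply/eqP; rewrite -subv0 /=; apply/lie_prod_subP => u v Zu Zv.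
  rewrite memv0; apply/eqP; elim/span_prop_ind: u / Zu => [|u w|k u|w].
  - by rewrite lie0l.
  - by rewrite lieDl => -> ->; rewrite addr0.
  - by rewrite lieZl => ->; rewrite scaler0.
  case/mapP=> b /ZP[Bb _ ->] {w}; elim/span_prop_ind: v / Zv => [|u w|k u|w].
  - by rewrite lie0r.
  - by rewrite lieDr => -> ->; rewrite addr0.
  - by rewrite lieZr => ->; rewrite scaler0.
  by case/mapP=> d /ZP[_ dC ->]; apply: dC.
move=> Z0; have : x c \in <<[seq x b | b <- Z]>>%VS by rewrite memv_span ?map_f.
by rewrite Z0 memv0 (negPf (root_vector_neq0 (BD _ Bc))).
Qed.

Lemma root_killing a : a \in D -> - a \in D /\ killing (x a) (x (- a)) != 0.
Proof.
move=> Da; have nK := killing_root_neq0 Da.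
split; first by apply: contrapT => nD; apply/nK/killing_root_eq0.
by apply/eqP => k0; apply/nK/killing_root_eq0.
Qed.

Lemma root_opp a : a \in D -> - a \in D.
Proof. by case/root_killing. Qed.

Lemma killing_opp_neq0 a : a \in D -> killing (x a) (x (- a)) != 0.
Proof. by case/root_killing. Qed.

Lemma coroot_h a : a \in D -> coroot x a \in h.
Proof. by move=> Da; apply: coroot_in_h (root_opp Da). Qed.

Lemma coroot_neq0 a : a \in D -> coroot x a != 0.
Proof.
move=> Da; apply/eqP => h0; have [t ht at0] := ev_neq0 (root_neq0 Da).
have := killing_coroot Da (root_opp Da) ht; rewrite h0 killing0l => /esym/eqP.
by rewrite mulf_eq0 (negPf at0) (negPf (killing_opp_neq0 Da)).
Qed.

Lemma ev_coroot_neq0 a : a \in D -> ev a (coroot x a) != 0.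
Proof.
move=> Da; apply/eqP => ah0; move/eqP: (coroot_neq0 Da); apply.
apply: coroot_isotropic (root_opp Da) _ => //.
by rewrite killing_coroot ?root_opp ?coroot_h // ah0 mul0r.
Qed.

Lemma lie_roots_sum a b : a \in D -> b \in D -> a + b \in D ->
  exists2 k, k != 0 & lie (x a) (x b) = k *: x (a + b).
Proof.
move=> Da Db Dab; have [k kE] := lie_roots_line Da Db Dab.
exists k => //; apply: contraTneq (lie_roots_neq0 Da (root_opp Da)
  (ev_coroot_neq0 Da) Db Dab) => k0; by rewrite kE k0 scale0r eqxx.
Qed.

(** * Subalgebras of root subsystems *)

Definition cospan E := <<[seq coroot x a | a <- E]>>%VS.

Definition rootspan E := <<[seq x a | a <- E]>>%VS.

(** Explicit form of the subalgebra generated by the x_a when E is a subsystem, see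
    [root_subalgebraE]; it allows inductions on generators. *)
Definition gensub E := (cospan E + rootspan E)%VS.

Lemma gensub_ind E (P : g -> Prop) :
  P 0 -> (forall u v, P u -> P v -> P (u + v)) ->
  (forall k u, P u -> P (k *: u)) ->
  (forall a, a \in E -> P (coroot x a)) -> (forall a, a \in E -> P (x a)) ->
  forall v, v \in gensub E -> P v.
Proof.
move=> P0 PD PZ Ph Px v /memv_addP[u Vu [w Vw ->]]; apply: (PD).
  by apply: (span_prop_ind P0 PD PZ _ Vu) => _ /mapP[a Ea ->]; apply: Ph.
by apply: (span_prop_ind P0 PD PZ _ Vw) => _ /mapP[a Ea ->]; apply: Px.
Qed.

Lemma coroot_cospan E a : a \in E -> coroot x a \in cospan E.
Proof. by move=> Ea; apply/memv_span/map_f. Qed.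

Lemma root_rootspan E a : a \in E -> x a \in rootspan E.
Proof. by move=> Ea; apply/memv_span/map_f. Qed.

Lemma coroot_gensub E a : a \in E -> coroot x a \in gensub E.
Proof. by move/coroot_cospan; apply: (subvP (addvSl _ _)). Qed.

Lemma root_gensub E a : a \in E -> x a \in gensub E.
Proof. by move/root_rootspan; apply: (subvP (addvSr _ _)). Qed.

Lemma cospan_h E : {subset E <= D} -> (cospan E <= h)%VS.
Proof. by move=> ED; apply/span_subvP => _ /mapP[a /ED Da ->];
  apply: coroot_h. Qed.

(** Conjugation on the complex span of the coroots. By [coroot_ratio] the roots are real on h_a /
    a(h_a), which dictates the conjugate of a generator; sums of squares become sums of |b(t)|^2. *)
Lemma cospan_conj E t : {subset E <= D} -> t \in cospan E ->
  exists2 s, s \in cospan E & forall b, b \in D -> ev b s = (ev b t)^*.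
Proof.
move=> ED; elim/span_prop_ind: t / => [|u v [s Es sE] [r Er rE]|k u [s Es
  sE]|w].
- by exists 0; rewrite ?mem0v // => b _; rewrite ev0 conjC0.
- exists (s + r); first exact: memvD.
  by move=> b Db; rewrite !evD sE // rE // rmorphD.
- exists (k^* *: s); first exact: memvZ.
  by move=> b Db; rewrite !evZ sE // rmorphM.
case/mapP=> a Ea ->; have Da := ED _ Ea; have ah := ev_coroot_neq0 Da.
exists (((ev a (coroot x a))^* / ev a (coroot x a)) *: coroot x a).
  exact/memvZ/coroot_cospan.
move=> b Db; have [r r_real rE] := coroot_ratio Da (root_opp Da) Db.
by rewrite evZ rE rmorphM /= (CrealP r_real) mulrCA divfK.
Qed.

Lemma cospan_orth E s t : {subset E <= D} -> s \in cospan E -> t \in h ->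
  (forall a, a \in E -> ev a t = 0) -> killing s t = 0.
Proof.
move=> ED Es ht t0; elim/span_prop_ind: s / Es => [|u v Hu Hv|k u Hu|w].
- exact: killing0l.
- by rewrite killingDl Hu Hv addr0.
- by rewrite killingZl Hu mulr0.
case/mapP=> a Ea ->; have Da := ED _ Ea.
by rewrite killing_coroot ?root_opp // t0 // mul0r.
Qed.

(** Pairing t with its conjugate gives the sum of |b(t)|^2 over all roots, which is 0; so t is
    central. *)
Lemma cospan_perp0 E t : {subset E <= D} -> t \in cospan E ->
  (forall a, a \in E -> ev a t = 0) -> t = 0.
Proof.
move=> ED Et t0; have ht := subvP (cospan_h ED) _ Et.
have [s Es sE] := cospan_conj ED Et; have hs := subvP (cospan_h ED) _ Es.
have /eqP := cospan_orth ED Es ht t0.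
rewrite killing_h // big_seq psumr_eq0 => [/allP sq0|a Da]; last first.
  by rewrite sE // mulrC mul_conjC_ge0.
apply: cartan_center => // [r hr|a Da]; first exact: cartan_abelian.
have := sq0 a Da; rewrite Da sE // mulrC mul_conjC_eq0.
by move/eqP.
Qed.

(* If t did not split, some combination of the roots in E would vanish on
   cospan E but not at t; as an element of cospan E it is orthogonal to E. *)
Lemma cospan_split E t : {subset E <= D} -> t \in h ->
  exists2 s, s \in cospan E & forall a, a \in E -> ev a s = ev a t.
Proof.
move=> ED ht; pose n := size E.
have ED' (i : 'I_n) : E`_i \in D by apply/ED/mem_nth.
pose A := \matrix_(i < n, j < n) ev E`_j (coroot x E`_i).
pose v := \row_(j < n) ev E`_j t.
have /submxP[w wE] : (v <= A)%MS.
  rewrite submxE; apply/eqP/matrixP => i0 j; rewrite [RHS]mxE [LHS]mxE.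
  pose d := cokermx A; pose m (i : 'I_n) := killing (x E`_i) (x (- E`_i)).
  have m0 i : m i != 0 by apply: killing_opp_neq0.
  (* Dividing by [m i] makes s represent, through the Killing form, the combination of roots with
     coefficients in column j of [d], which vanishes on [cospan E]. *)
  pose s := \sum_(i < n) (d i j / m i) *: coroot x E`_i.
  have Es : s \in cospan E.
    by apply: memv_suml => i _; apply/memvZ/coroot_cospan/mem_nth.
  have kE r : r \in h -> killing s r = \sum_(i < n) ev E`_i r * d i j.
    move=> hr; rewrite killing_suml; apply: eq_bigr => i _.
    rewrite killingZl killing_coroot ?root_opp // -/(m i).
    by rewrite [ev _ _ * _]mulrC mulrA divfK // mulrC.
  have s0 : s = 0.
    apply: (cospan_perp0 ED Es) => a Ea.
    have iE : (index a E < n)%N by rewrite index_mem.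
    have Da := ED _ Ea.
    have := kE _ (coroot_h Da); rewrite killingC killing_coroot ?root_opp //.
      move=> /eqP; rewrite [X in _ == X -> _](_ : _ = 0).
        by rewrite mulf_eq0 (negPf (killing_opp_neq0 Da)) orbF => /eqP.
      have /matrixP/(_ (Ordinal iE) j) := mulmx_coker A; rewrite !mxE => Ad.
      by rewrite -[RHS]Ad; apply: eq_bigr => i _; rewrite !mxE /= nth_index.
    exact: (subvP (cospan_h ED)).
  have := kE t ht; rewrite s0 killing0l => ks.
  by rewrite [RHS]ks; apply: eq_bigr => i _; rewrite mxE.
exists (\sum_(i < n) w 0 i *: coroot x E`_i).
  by apply: memv_suml => i _; apply/memvZ/coroot_cospan/mem_nth.
move=> a Ea; have iE : (index a E < n)%N by rewrite index_mem.
have /matrixP/(_ 0 (Ordinal iE)) := wE; rewrite !mxE /= nth_index // => ->.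
by rewrite ev_sum; apply: eq_bigr => i _; rewrite evZ !mxE /= nth_index.
Qed.

(** The element representing a - b through the Killing form lies in [cospan E] and is killed by all
    roots of E. *)
Lemma cospan_sep E a b : {subset E <= D} -> a \in E -> b \in E ->
  (forall s, s \in cospan E -> ev a s = ev b s) -> a = b.
Proof.
move=> ED Ea Eb ab; have Da := ED _ Ea; have Db := ED _ Eb.
pose m c := killing (x c) (x (- c)).
pose s := (m a)^-1 *: coroot x a - (m b)^-1 *: coroot x b.
have Es : s \in cospan E by rewrite memvB ?memvZ ?coroot_cospan.
have hs := subvP (cospan_h ED) _ Es.
have kE t : t \in h -> killing s t = ev a t - ev b t.
  move=> ht; rewrite killingDl killingNl !killingZl !killing_coroot ?root_opp
    //.
  by rewrite !(mulrC (_^-1)) !mulfK // killing_opp_neq0.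
have s0 : s = 0.
  apply: (cospan_perp0 ED Es) => c Ec; have Dc := ED _ Ec.
  apply: (mulIf (killing_opp_neq0 Dc)).
  rewrite mul0r -killing_coroot ?root_opp // killingC kE ?coroot_h //.
  by rewrite ab ?subrr // coroot_cospan.
apply: ev_inj => t ht; apply/eqP; rewrite -subr_eq0 -kE // s0.
by rewrite killing0l.
Qed.

Section Subsystem.
Variable E : seq (hdual h).
Hypothesis Esub : root_subsystem D E.

Let ED : {subset E <= D}. Proof. by case: Esub. Qed.
Let EN a : a \in E -> - a \in E. Proof. by case: Esub => _ + _; apply. Qed.
Let ES a b : a \in E -> b \in E -> a + b \in D -> a + b \in E.
Proof. by case: Esub => _ _; apply. Qed.

Lemma lie_gensub u v : u \in gensub E -> v \in gensub E -> lie u v \in gensub E.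
Proof.
move=> Gu Gv; elim/gensub_ind: v / Gv => [|v w|k v|b Eb|b Eb].
- by rewrite lie0r mem0v.
- by rewrite lieDr; apply: memvD.
- by rewrite lieZr; apply: memvZ.
- elim/gensub_ind: u / Gu => [|v w|k v|a Ea|a Ea].
  + by rewrite lie0l mem0v.
  + by rewrite lieDl; apply: memvD.
  + by rewrite lieZl; apply: memvZ.
  + by rewrite cartan_abelian ?mem0v // coroot_h ?ED.
  by rewrite lieC lie_h_root ?coroot_h ?ED // memvN memvZ ?root_gensub.
elim/gensub_ind: u / Gu => [|v w|k v|a Ea|a Ea].
- by rewrite lie0l mem0v.
- by rewrite lieDl; apply: memvD.
- by rewrite lieZl; apply: memvZ.
- by rewrite lie_h_root ?coroot_h ?ED // memvZ ?root_gensub.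
have [Da Db] := (ED Ea, ED Eb).
have [/eqP|ab0] := eqVneq (a + b) 0.
  rewrite addr_eq0 -eqr_oppLR => /eqP <-; exact: coroot_gensub.
have [Dab|nDab] := boolP (a + b \in D); last by rewrite lie_roots_notin ?mem0v.
have [k kE] := lie_roots_line Da Db Dab.
by rewrite kE memvZ // root_gensub // ES.
Qed.

Lemma root_subalgebraE : root_subalgebra x E = gensub E.
Proof.
apply/eqP; rewrite eqEsubv; apply/andP; split.
  apply: lie_gen_min; first exact: lie_gensub.
  by move=> _ /mapP[a Ea ->]; apply: root_gensub.
have sG : {subset [seq x a | a <- E] <= root_subalgebra x E}.
  by move=> v Ev; apply/(subvP (sub_lie_gen _))/memv_span.
rewrite subv_add; apply/andP; split; apply/span_subvP => _ /mapP[a Ea ->].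
  by apply: lie_gen_subalg; apply/sG/map_f; rewrite ?EN.
by apply/sG/map_f.
Qed.

(** Only [cospan E] acts on V, since an ideal of [gensub E] is not known beforehand to be stable
    under h. The weights stay distinct there by [cospan_sep], so V contains the components of its
    vectors. *)
Lemma gensub_graded V v : (V <= gensub E)%VS ->
  (forall s u, s \in cospan E -> u \in V -> lie s u \in V) -> v \in V ->
  exists t, [/\ t \in cospan E, t \in V
    & v - t \in rootspan [seq a <- E | x a \in V]].
Proof.
move=> VG Vst Vv; have /memv_addP[t Et [w Ew vE]] := subvP VG _ Vv.
have [|k wE] := @span_map_uniq _ x (undup E) w (undup_uniq E).
  suff -> : <<[seq x a | a <- undup E]>>%VS = rootspan E by [].
  by apply: eq_span => u; apply/mapP/mapP => -[a]; rewrite ?mem_undup => Ea ->;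
    exists a; rewrite ?mem_undup.
have nE0 : 0 \notin undup E.
  by rewrite mem_undup; apply/negP => /ED /root_neq0; rewrite eqxx.
(* The key 0, which is not a root, stands for the Cartan component t. *)
pose f a := if a == 0 then t else k a *: x a.
have f0 a : a \in undup E -> f a = k a *: x a.
  by rewrite /f; case: eqP => // ->; rewrite (negPf nE0).
have ht := subvP (cospan_h ED) _ Et.
have Vf a : a \in 0 :: undup E -> f a \in V.
  move: a; apply: (@weights_separated _ g (subvs_of (cospan E)) _ (0 :: undup E)
    (fun r => lie (vsval r)) (fun a r => ev a (vsval r)) f V).
  - by move=> s; apply: lie_linearr.
  - by move=> s u; apply: Vst; apply: subvsP.
  - move=> b s; rewrite inE => /predU1P[->|Eb]; have Es := subvsP s;
      have hs := subvP (cospan_h ED) _ Es.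
      by rewrite /f eqxx ev0l scale0r cartan_abelian.
    by rewrite f0 // lieZr lie_h_root // ?scalerA 1?mulrC //; apply: ED;
      rewrite -mem_undup.
  - have sep0 b : b \in undup E -> exists s : subvs_of (cospan E),
        ev b (vsval s) != ev 0 (vsval s).
      rewrite mem_undup => Eb; exists (vsproj _ (coroot x b)).
      by rewrite vsprojK ?coroot_cospan // ev0l ev_coroot_neq0 ?ED.
    move=> b c; rewrite !inE => /predU1P[->|Eb] /predU1P[->|Ec] bc.
    + by rewrite eqxx in bc.
    + by have [s] := sep0 c Ec; exists s; rewrite eq_sym.
    + exact: sep0.
    apply: contrapT => H; move/eqP: bc; apply; apply: (cospan_sep ED).
    + by rewrite -mem_undup.
    + by rewrite -mem_undup.
    move=> s Es; apply: contrapT => /eqP nbc; apply: H.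
    by exists (vsproj _ s); rewrite vsprojK.
  - by rewrite /= nE0 undup_uniq.
  rewrite big_cons {1}/f eqxx (eq_big_seq (fun a => k a *: x a)) //.
  by rewrite -wE -vE.
exists t; split=> //; first by have := Vf 0; rewrite mem_head /f eqxx; apply.
rewrite vE addrC addKr wE big_seq; apply: memv_suml => a Ea.
have [-> |k0] := eqVneq (k a) 0; first by rewrite scale0r mem0v.
apply/memvZ/root_rootspan; rewrite mem_filter -mem_undup Ea andbT.
have := Vf a; rewrite inE Ea orbT f0 // => /(_ isT) /(memvZ (k a)^-1).
by rewrite scalerK.
Qed.

(** * Ideals of the root subalgebra *)

Section Ideal.
Variable I : {vspace g}.
Hypothesis I_ideal : lie_ideal (gensub E) I.

Let S := [seq a <- E | x a \in I].
Let S' := [seq a <- E | x a \notin I].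

Let IG : (I <= gensub E)%VS. Proof. by case: I_ideal. Qed.
Let lieI u v : u \in gensub E -> v \in I -> lie u v \in I.
Proof. by case: I_ideal => _ /lie_prod_subP; apply. Qed.

Let SP a : (a \in S) = (x a \in I) && (a \in E). Proof. exact: mem_filter. Qed.
Let S'P a : (a \in S') = (x a \notin I) && (a \in E). Proof. exact: mem_filter.
  Qed.

Let corootI a : a \in E -> x a \in I -> coroot x a \in I.
Proof.
by move=> Ea Ia; rewrite /coroot lieC memvN lieI // root_gensub ?EN.
Qed.

Let opp_I a : a \in E -> x a \in I -> x (- a) \in I.
Proof.
move=> Ea Ia; have Da := ED Ea; have ENa := EN Ea.
have : lie (x (- a)) (coroot x a) \in I by rewrite lieI ?corootI ?root_gensub.
rewrite lieC lie_corootE ?root_opp // evNl scaleNr opprK.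
move/(memvZ (ev a (coroot x a))^-1); rewrite scalerK //.
exact: ev_coroot_neq0.
Qed.

Let addI a b : a \in E -> b \in E -> a + b \in D -> x b \in I -> x (a + b) \in
  I.
Proof.
move=> Ea Eb Dab Ib; have [k k0 kE] := lie_roots_sum (ED Ea) (ED Eb) Dab.
have : lie (x a) (x b) \in I by rewrite lieI ?root_gensub.
by rewrite kE => /(memvZ k^-1); rewrite scalerK.
Qed.

Lemma ideal_roots_subsystem : root_subsystem D S.
Proof.
split=> [a|a|a b]; rewrite !SP.
- by case/andP=> _ /ED.
- by case/andP=> Ia Ea; rewrite opp_I ?EN.
by case/andP=> Ia Ea /andP[Ib Eb] Dab; rewrite addI ?ES.
Qed.

Lemma ideal_complement_subsystem : root_subsystem D S'.
Proof.
split=> [a|a|a b]; rewrite !S'P.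
- by case/andP=> _ /ED.
- case/andP=> Ia Ea; rewrite EN // andbT; apply: contra Ia => Ia.
  by rewrite -[a]opprK opp_I ?EN.
case/andP=> Ia Ea /andP[Ib Eb] Dab; rewrite ES // andbT.
apply: contra Ia => Iab; rewrite -[a](addrK b) addrC addI ?EN ?ES //.
by rewrite addrC addrK ED.
Qed.

(** A nonzero bracket or a nonzero value b(h_a) would pull x_b into the ideal. *)
Lemma ideal_roots_commute a b : a \in S -> b \in S' ->
  lie (x a) (x b) = 0 /\ ev b (coroot x a) = 0.
Proof.
rewrite SP S'P => /andP[Ia Ea] /andP[Ib Eb]; have [Da Db] := (ED Ea, ED Eb).
split.
  have [/eqP|ab0] := eqVneq (a + b) 0.
    rewrite addrC addr_eq0 => /eqP bE; by rewrite bE opp_I in Ib.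
  have [Dab|nDab] := boolP (a + b \in D); last exact: lie_roots_notin.
  case/negP: Ib; rewrite -[b](addKr a) addI ?EN ?ES // ?addKr //.
  by rewrite addrC addI // addrC.
apply/eqP; apply: contraNT Ib => ab.
have : lie (coroot x a) (x b) \in I.
  by rewrite lieC memvN lieI ?corootI ?root_gensub.
by rewrite lie_h_root ?coroot_h // => /(memvZ (ev b (coroot x a))^-1);
  rewrite scalerK.
Qed.

Lemma ideal_gensub_commute u v : u \in gensub S -> v \in gensub S' -> lie u v =
  0.
Proof.
have SE a : a \in S -> a \in E by rewrite SP => /andP[].
have S'E a : a \in S' -> a \in E by rewrite S'P => /andP[].
move=> Gu Gv; elim/gensub_ind: v / Gv => [|v w Hv Hw|k v Hv|b Eb|b Eb].
- by rewrite lie0r.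
- by rewrite lieDr Hv Hw addr0.
- by rewrite lieZr Hv scaler0.
- elim/gensub_ind: u / Gu => [|v w Hv Hw|k v Hv|a Ea|a Ea].
  + by rewrite lie0l.
  + by rewrite lieDl Hv Hw addr0.
  + by rewrite lieZl Hv scaler0.
  + by apply: cartan_abelian; apply/coroot_h/ED; [apply: SE | apply: S'E].
  have [ab0 _] := ideal_roots_commute Ea Eb.
  have [|ab1 _] := ideal_roots_commute Ea (_ : - b \in S').
    by case: ideal_complement_subsystem => _ + _; apply.
  by rewrite /coroot lie_leibniz ab0 lie0l add0r ab1 lie0r.
elim/gensub_ind: u / Gu => [|v w Hv Hw|k v Hv|a Ea|a Ea].
- by rewrite lie0l.
- by rewrite lieDl Hv Hw addr0.
- by rewrite lieZl Hv scaler0.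
- have [_ ab0] := ideal_roots_commute Ea Eb.
  have hb : coroot x a \in h by apply/coroot_h/ED/SE.
  by rewrite lie_h_root ?ab0 ?scale0r //; apply/ED/S'E.
by have [] := ideal_roots_commute Ea Eb.
Qed.

(** The point is the Cartan part t of a vector of I. Subtract the s in [cospan S] with the same
    values on S: a root a of E outside S with a(t - s) <> 0 would put x_a into I, so t - s is killed
    by E and vanishes. *)
Lemma ideal_gensubE : I = gensub S.
Proof.
apply/eqP; rewrite eqEsubv; apply/andP; split; last first.
  rewrite subv_add; apply/andP; split; apply/span_subvP => _ /mapP[a Sa ->];
    move: Sa; rewrite SP => /andP[Ia Ea] //.
  exact: corootI.
have SD : {subset S <= D} by case: ideal_roots_subsystem.
have SE a : a \in S -> a \in E by rewrite SP => /andP[].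
apply/subvP => v Iv.
have [|t [Et It vt]] := @gensub_graded I v IG _ Iv.
  by move=> s u Es; apply: lieI; apply: subvP (addvSl _ _) _ Es.
have [s Ss sE] := cospan_split SD (subvP (cospan_h ED) _ Et).
have Es : s \in cospan E.
  by apply: subvP Ss; apply: sub_span => _ /mapP[a /SE Ea ->]; apply: map_f.
have Is : s \in I.
  move: s Ss {sE Es}; apply/subvP/span_subvP => _ /mapP[a Sa ->].
  by move: Sa; rewrite SP => /andP[Ia Ea]; apply: corootI.
have ts : t - s = 0.
  apply: (cospan_perp0 ED); first exact: memvB.
  move=> a Ea; rewrite evD evN; have [Sa|] := boolP (a \in S).
    by rewrite sE // subrr.
  rewrite SP Ea andbT -evN -evD => nIa; apply/eqP; apply: contraNT nIa => nz.
  have : lie (x a) (t - s) \in I by rewrite lieI ?memvB ?root_gensub.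
  rewrite lieC memvN lie_h_root ?ED //.
    by move/(memvZ (ev a (t - s))^-1); rewrite scalerK.
  exact/(subvP (cospan_h ED))/memvB.
rewrite -(subrK t v) addrC memv_add //.
by move/eqP: ts; rewrite subr_eq0 => /eqP ->.
Qed.

End Ideal.

End Subsystem.

(** * Semisimplicity and simple summands *)

Lemma gensub_nil : gensub [::] = 0%VS.
Proof. by rewrite /gensub /cospan /rootspan /= span_nil addv0. Qed.

(** A nonzero ideal contains x_a, x_(-a) and h_a for some a, and this triple survives in every term
    of the derived series. *)
Lemma gensub_semisimple E : root_subsystem D E -> lie_semisimple (gensub E).
Proof.
move=> Esub I I_ideal [k Ik]; have [ED EN _] := Esub.
rewrite (ideal_gensubE Esub I_ideal).
case SE: [seq a <- E | x a \in I] => [|a S]; first exact: gensub_nil.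
have : a \in [seq a <- E | x a \in I] by rewrite SE mem_head.
have [_ SN _] := ideal_roots_subsystem Esub I_ideal.
move=> Sa; have := SN a Sa; move: Sa; rewrite !mem_filter.
case/andP=> Ia Ea /andP[INa _]; have Da := ED _ Ea; have DNa := root_opp Da.
have [iter_a _ _] : [/\ x a \in iter k (fun V => lie_prod V V) I,
    x (- a) \in iter k (fun V => lie_prod V V) I
  & coroot x a \in iter k (fun V => lie_prod V V) I].
  elim: k {Ik} => [|k [Ha HNa Hh]] /=.
    split=> //; case: I_ideal => _ /lie_prod_subP; apply=> //.
    exact: root_gensub.
  have ah := ev_coroot_neq0 Da; split; last exact: mem_lie_prod.
    have := mem_lie_prod Hh Ha; rewrite lie_corootE //.
    by move/(memvZ (ev a (coroot x a))^-1); rewrite scalerK.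
  have := mem_lie_prod Hh HNa; rewrite lie_corootE // evNl.
  by move/(memvZ (- ev a (coroot x a))^-1); rewrite scalerK ?oppr_eq0.
by move: iter_a; rewrite Ik memv0 (negPf (root_vector_neq0 Da)).
Qed.

(** Induction on the size of E: a proper nonzero ideal splits E into two smaller subsystems with
    commuting subalgebras. These meet in 0, since a common vector is central. *)
Lemma gensub_decomposition E : root_subsystem D E ->
  exists r, simple_decomposition (gensub E) r.
Proof.
have [n] := ubnP (size E); elim: n E => // n IHn E ltn Esub.
have [ED EN ES] := Esub.
have [E0|[a Ea]] : E = [::] \/ exists a, a \in E.
  by case: (E) => [|b F]; [left | right; exists b; rewrite mem_head].
  exists [::]; rewrite E0 gensub_nil; split; rewrite ?big_nil //.
  by rewrite directvE /= !big_nil dimv0.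
have Da := ED _ Ea.
have [[I [I_ideal I0 IE]]|all_trivial] := EM (exists I,
    [/\ lie_ideal (gensub E) I, I != 0%VS & I != gensub E]); last first.
  exists [:: gensub E]; split; last 2 first.
  - by rewrite big_seq1.
  - by rewrite directvE /= !big_seq1.
  move=> _ /[!inE]/eqP->;
    have GG : (lie_prod (gensub E) (gensub E) <= gensub E)%VS.
    by apply/lie_prod_subP; apply: lie_gensub.
  split; first by split; [apply: subvv|].
  split=> [G0|I I_ideal].
    have := coroot_neq0 Da; rewrite -memv0 -G0.
    by rewrite mem_lie_prod ?root_gensub ?EN.
  have [->|I0] := eqVneq I 0%VS; first by left.
  have [->|IE] := eqVneq I (gensub E); first by right.
  by case: all_trivial; exists I.
pose S := [seq b <- E | x b \in I]; pose S' := [seq b <- E | x b \notin I].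
have Ssub : root_subsystem D S := ideal_roots_subsystem Esub I_ideal.
have S'sub : root_subsystem D S' := ideal_complement_subsystem Esub I_ideal.
have IS : I = gensub S := ideal_gensubE Esub I_ideal.
have comm : forall u v, u \in gensub S -> v \in gensub S' -> lie u v = 0 :=
  ideal_gensub_commute Esub I_ideal.
have ltS : (size S < n)%N.
  rewrite (leq_trans _ (_ : size E <= n)%N) // size_filter -(count_predC (fun b
    => x b \in I) E).
  rewrite -[X in (X < _)%N]addn0 ltn_add2l -has_count;
    apply: contraNT IE => nS'.
  rewrite IS /S; suff -> : [seq b <- E | x b \in I] = E by [].
  by apply/all_filterP; rewrite -[all _ _]negbK -has_predC.
have ltS' : (size S' < n)%N.
  rewrite (leq_trans _ (_ : size E <= n)%N) // size_filter -(count_predC (fun b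
    => x b \in I) E).
  rewrite -[X in (X < _)%N]add0n ltn_add2r -has_count; apply: contraNT I0 => nS.
  rewrite IS /S; suff -> : [seq b <- E | x b \in I] = [::] by rewrite
    gensub_nil.
  by apply/eqP; rewrite -size_eq0 size_filter eqn0Ngt -has_count.
have GE : gensub E = (gensub S + gensub S')%VS.
  apply/eqP; rewrite eqEsubv; apply/andP; split; last first.
    have mono F : {subset F <= E} -> (gensub F <= gensub E)%VS.
      by move=> FE; apply/subvP => v;
        elim/gensub_ind: v / => [|u v|k u|b /FE|b /FE];
        [apply: mem0v | apply: memvD | apply: memvZ | apply: coroot_gensub |
          apply: root_gensub].
    by rewrite subv_add !mono // => b; rewrite mem_filter => /andP[].
  apply/subvP => v; elim/gensub_ind: v / => [|u v|k u|b Eb|b Eb];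
    [apply: mem0v | apply: memvD | apply: memvZ | |].
    have [Ib|nIb] := boolP (x b \in I).
      by apply/(subvP (addvSl _ _))/coroot_gensub; rewrite mem_filter Ib.
    by apply/(subvP (addvSr _ _))/coroot_gensub; rewrite mem_filter nIb.
  have [Ib|nIb] := boolP (x b \in I).
    by apply/(subvP (addvSl _ _))/root_gensub; rewrite mem_filter Ib.
  by apply/(subvP (addvSr _ _))/root_gensub; rewrite mem_filter nIb.
have cap0 : (gensub S :&: gensub S' = 0)%VS.
  apply/eqP; rewrite -subv0; apply/subvP => v;
    rewrite memv_cap memv0 => /andP[Sv S'v].
  apply/eqP/(semisimple_center (gensub_semisimple Esub)).
    by rewrite GE (subvP (addvSl _ _)).
  rewrite GE => _ /memv_addP[u Su [w S'w ->]].
  by rewrite lieDl comm // lieC comm // oppr0 addr0.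
have [[s [s_id sE sdir]] [s' [s'_id s'E s'dir]]] := (IHn S ltS Ssub, IHn S'
  ltS' S'sub).
exists (s ++ s'); split.
- move=> V; rewrite mem_cat => /orP[/s_id|/s'_id] [[VS VI] Vs]; split=> //.
    split; first by rewrite GE (subv_trans VS) ?addvSl.
    rewrite GE; apply/lie_prod_subP => _ v /memv_addP[u Su [w S'w ->]] Vv.
    rewrite lieDl (lieC w) (comm v) ?(subvP VS) // oppr0 addr0.
    by apply: (subvP VI); apply: mem_lie_prod.
  split; first by rewrite GE (subv_trans VS) ?addvSr.
  rewrite GE; apply/lie_prod_subP => _ v /memv_addP[u Su [w S'w ->]] Vv.
  rewrite lieDl (comm u) ?(subvP VS) // add0r.
  by apply: (subvP VI); apply: mem_lie_prod.
- by rewrite GE big_cat -sE -s'E.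
move: sdir s'dir; rewrite !directvE /= !big_cat /= -sE -s'E => /eqP <- /eqP <-.
by rewrite dimv_disjoint_sum.
Qed.

Lemma sumv_ind (r : seq {vspace g}) (P : g -> Prop) :
  P 0 -> (forall u v, P u -> P v -> P (u + v)) ->
  (forall V v, V \in r -> v \in V -> P v) ->
  forall v, v \in (\sum_(V <- r) V)%VS -> P v.
Proof.
move=> P0 PD; elim: r => [|V r IHr] PV v.
  by rewrite big_nil memv0 => /eqP ->.
rewrite big_cons => /memv_addP[u Vu [w rw ->]]; apply: (PD).
  by apply: (PV V) => //; apply: mem_head.
by apply: IHr rw => W e rW; apply: PV; rewrite inE rW orbT.
Qed.

Lemma ideal_root_commute E I a u : root_subsystem D E ->
  lie_ideal (gensub E) I -> a \in E -> x a \notin I -> u \in I ->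
  lie u (x a) = 0.
Proof.
move=> Esub I_ideal Ea nIa; rewrite {1}(ideal_gensubE Esub I_ideal) => Iu.
apply: (ideal_gensub_commute Esub I_ideal Iu).
by apply: root_gensub; rewrite mem_filter nIa.
Qed.

(** Turns constancy on summands into a condition on pairs of roots. Every x_a lies in a summand, for
    otherwise it would be central; root vectors of E outside that summand commute with x_a and
    h_a. *)
Lemma summand_linked E xi a b : root_subsystem D E ->
  summand_constants x E xi -> a \in E -> b \in E ->
  lie (x a) (x b) != 0 \/ ev b (coroot x a) != 0 -> xi a = xi b.
Proof.
move=> Esub [_ xiE] Ea Eb link; have [ED EN _] := Esub.
have [r [r_id rE rdir]] := gensub_decomposition Esub.
have [[V rV Va]|none] := EM (exists2 V, V \in r & x a \in V); last first.
  have /eqP : x a = 0; last by rewrite (negPf (root_vector_neq0 (ED _ Ea))).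
  apply: (semisimple_center (gensub_semisimple Esub)); first exact: root_gensub.
  move=> u; rewrite rE; elim/sumv_ind: u / => [|u v Hu Hv|V v rV Vv].
  - by rewrite lie0l.
  - by rewrite lieDl Hu Hv addr0.
  have [V_id _] := r_id V rV; apply: (ideal_root_commute Esub V_id Ea _ Vv).
  by apply/negP => Va; apply: none; exists V.
have [V_id _] := r_id V rV.
apply: (xiE V) => //; first by exists r; rewrite // root_subalgebraE.
apply: contrapT => /negP nVb; case: link => /eqP; apply.
  exact: (ideal_root_commute Esub V_id).
have Vh : coroot x a \in V.
  case: V_id => _ /lie_prod_subP VI.
  by rewrite /coroot lieC memvN VI // root_gensub ?EN.
have /eqP := ideal_root_commute Esub V_id Eb nVb Vh.
rewrite lie_h_root ?coroot_h ?ED // scaler_eq0.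
by rewrite (negPf (root_vector_neq0 (ED _ Eb))) orbF => /eqP.
Qed.

Lemma summand_opp E xi a : root_subsystem D E ->
  summand_constants x E xi -> a \in E -> xi (- a) = xi a.
Proof.
move=> Esub xiE Ea; have [ED EN _] := Esub; symmetry.
by apply: (summand_linked Esub xiE); rewrite ?EN //; left;
  apply: coroot_neq0 (ED _ Ea).
Qed.

Lemma summand_sum E xi a b : root_subsystem D E ->
  summand_constants x E xi -> a \in E -> b \in E -> a + b \in D ->
  xi (a + b) = xi b.
Proof.
move=> Esub xiE Ea Eb Dab; have [ED EN ES] := Esub.
have nz c d : c \in E -> d \in E -> c + d \in D -> lie (x c) (x d) != 0.
  move=> /ED Dc /ED Dd Dcd.
  exact: lie_roots_neq0 (root_opp Dc) (ev_coroot_neq0 Dc) Dd Dcd.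
rewrite -(summand_linked Esub xiE Ea Eb); last by left; apply: nz.
rewrite -(summand_opp Esub xiE Ea).
symmetry; apply: (summand_linked Esub xiE); rewrite ?EN ?ES //.
by left; apply: nz; rewrite ?EN ?ES // addKr ED.
Qed.

(** Schur's argument: the k-eigenspace of phi in V is an ideal of V, and it contains v. *)
Lemma simple_eigenspace (phi : 'End(g)) k (V : {vspace g}) v : subalgebra V ->
  lie_simple V ->
  (forall u w, u \in V -> phi (lie u w) = lie u (phi w)) ->
  v \in V -> v != 0 -> phi v = k *: v -> forall w, w \in V -> phi w = k *: w.
Proof.
move=> subV [_ Vs] comm Vv v0 phiv.
have kerP w : (w \in lker (phi - k *: \1%VF)) = (phi w == k *: w).
  by rewrite memv_ker add_lfunE opp_lfunE scale_lfunE id_lfunE subr_eq0.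
have [|W0|WV] := Vs (V :&: lker (phi - k *: \1%VF))%VS.
- split; first exact: capvSl.
  apply/lie_prod_subP => u w Vu; rewrite !memv_cap !kerP => /andP[Vw /eqP phiw].
  by rewrite comm // phiw lieZr eqxx andbT subV.
- have : v \in (V :&: lker (phi - k *: \1%VF))%VS by rewrite memv_cap Vv kerP
  phiv /=.
  by rewrite W0 memv0 (negPf v0).
by move=> w; rewrite -WV memv_cap kerP => /andP[_ /eqP].
Qed.

Lemma ideal_subalgebra (U V : {vspace g}) : lie_ideal U V -> subalgebra V.
Proof.
by case=> VU /lie_prod_subP UV u v Vu; apply: UV; apply: (subvP VU).
Qed.

(** * Averaging operators *)

Section Necessity.
Variables (N : nat) (T : nat -> 'End(g)).
Hypothesis T_degree : degree_le N T.
Hypothesis T_avg : averaging T.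
Hypothesis T_h : sub_Tstar h N T.

Local Notation P n u := (Tpoly T u n).

Let avE u v i j := (averagingP T).1 T_avg u v i j.

Let vanish_above m := forall n k u v, (m < n)%N -> P n (lie (P k u) v) = 0.

Let h_ind (Q : g -> Prop) : Q 0 -> (forall u v, Q u -> Q v -> Q (u + v)) ->
  (forall k u, Q u -> Q (k *: u)) -> (forall k u, Q (P k u)) ->
  forall t, t \in h -> Q t.
Proof.
move=> Q0 QD QZ QP t /T_h; apply: Tstar_ind => // a u _.
by rewrite /Tval; elim/big_ind: _ => // k _; apply: QZ.
Qed.

Let comm_image m k u v : vanish_above m -> P m (lie (P k u) v) = lie (P k u) (P
  m v).
Proof.
move=> van; rewrite -avE big_ord_recr /= subnn add0n bin0 scale1r.
rewrite big1 ?add0r // => j _; rewrite van ?scaler0 //.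
by rewrite -[X in (X < _)%N]add0n ltn_add2r subn_gt0.
Qed.

Let comm_h m t v : vanish_above m -> t \in h -> P m (lie t v) = lie t (P m v).
Proof.
move=> van; elim/h_ind: t / => [|t s Ht Hs|k t Ht|k t].
- by rewrite !lie0l Tpoly0.
- by rewrite !lieDl TpolyD Ht Hs.
- by rewrite !lieZl TpolyZ Ht.
exact: comm_image.
Qed.

Let P_root m b : vanish_above m -> b \in D -> exists k, P m (x b) = k *: x b.
Proof.
move=> van Db; apply: weight_line => // t ht.
by rewrite -comm_h // lie_h_root // TpolyZ.
Qed.

(** x_b is a multiple of [t, x_b] for some t in h, and t is a combination of vectors P_k u. *)
Let P_root_above m n b : vanish_above m -> (m < n)%N -> b \in D -> P n (x b) =
  0.
Proof.
move=> van ltmn Db; have [t ht bt] := ev_neq0 (root_neq0 Db).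
apply: (scalerI bt); rewrite scaler0 -TpolyZ -lie_h_root //.
elim/h_ind: t / ht {bt} => [|t s Ht Hs|k t Ht|k t].
- by rewrite lie0l Tpoly0.
- by rewrite lieDl TpolyD Ht Hs addr0.
- by rewrite lieZl TpolyZ Ht scaler0.
exact: van.
Qed.

(* The coefficient of lambda^(m + 1) mu^(m - 1) of the averaging identity at
   x b isolates P_m [P_m x_b, v]. *)
Let P_root_top m b : vanish_above m.+1 -> b \in D -> P m.+1 (x b) = 0.
Proof.
move=> van Db; have [k kE] := P_root van Db.
have [kz|k0] := eqVneq k 0; first by rewrite kE kz scale0r.
have [t ht bt] := ev_neq0 (root_neq0 Db).
have := avE (x b) t m.+2 m; have top0 := P_root_above van (ltnSn _) Db;
  rewrite top0 lie0l.
(* The two last terms: k = m + 2, zero by [top0], and k = m + 1, whose binomial coefficient is m +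
   1. *)
rewrite big_ord_recr big_ord_recr /= top0 lie0l Tpoly0 scaler0 addr0.
rewrite big1 ?add0r => [|j _]; last first.
  rewrite van ?scaler0 // -[X in (X < _)%N]add1n ltn_add2r ltn_subRL addn1.
  by rewrite ltnS (ltn_ord j).
rewrite subSnn bin1 add1n kE lieZl lieC lie_h_root // TpolyZ TpolyN TpolyZ kE.
move/eqP; rewrite !scalerN oppr_eq0 !scaler_eq0 pnatr_eq0 /=.
by rewrite (negPf k0) (negPf bt) (negPf (root_vector_neq0 Db)).
Qed.

(** For v a root vector, P_(m+1) moves onto v and kills it; for v in h, [P_k u, v] is a combination
    of root vectors, killed as well. *)
Let vanish_step m : vanish_above m.+1 -> vanish_above m.
Proof.
move=> van n k u v; rewrite leq_eqVlt => /predU1P[<-|]; last exact: van.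
elim/generic_ind: v => [v w Hv Hw|l v Hv|t ht|b Db].
- by rewrite lieDr TpolyD Hv Hw addr0.
- by rewrite lieZr TpolyZ Hv scaler0.
- elim/generic_ind: (P k u) => [v w Hv Hw|l v Hv|s hs|b Db].
  + by rewrite lieDl TpolyD Hv Hw addr0.
  + by rewrite lieZl TpolyZ Hv scaler0.
  + by rewrite cartan_abelian // Tpoly0.
  by rewrite lieC lie_h_root // TpolyN TpolyZ P_root_top // scaler0 oppr0.
by rewrite comm_image // P_root_top // lie0r.
Qed.

Let vanish0 : vanish_above 0.
Proof.
have : vanish_above N.
  by move=> n k u v ltNn; rewrite /Tpoly (T_degree ltNn) zero_lfunE scaler0.
by elim: N => // m IHm /vanish_step /IHm.
Qed.

Let vanish m : vanish_above m.
Proof. by move=> n k u v ltmn; apply: vanish0; apply: leq_ltn_trans ltmn. Qed.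

Lemma averaging_described :
  exists E, root_subsystem D E /\
    exists2 xi, summand_constants x E xi & described D x E xi T.
Proof.
have [eta etaE] : exists eta : hdual h -> C,
    forall b, b \in D -> P 0 (x b) = eta b *: x b.
  suff /choice : forall b, exists k, b \in D -> P 0 (x b) = k *: x b.
    by case=> eta; exists eta.
  move=> b; have [Db|nDb] := boolP (b \in D); last by exists 0.
  by have [k] := P_root (@vanish 0) Db; exists k.
have P_root0 n b : b \in D -> P n.+1 (x b) = 0 by exact: (P_root_above
  (@vanish0)).
pose E := [seq b <- D | eta b != 0].
have EP b : (b \in E) = (eta b != 0) && (b \in D) by rewrite mem_filter.
have ED b : b \in E -> b \in D by rewrite EP => /andP[].
have E0 b : b \in E -> eta b != 0 by rewrite EP => /andP[].
(* For b in E the vector x_b is itself a value of P_0, so every P_n commutes with ad x_b. *)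
have commE b n v : b \in E -> P n (lie (x b) v) = lie (x b) (P n v).
  move=> Eb; have -> : x b = P 0 ((eta b)^-1 *: x b).
    by rewrite TpolyZ etaE ?ED // scalerK ?E0.
  exact: comm_image (@vanish n).
have PE b : b \in E -> P 0 (coroot x b) = eta (- b) *: coroot x b.
  by move=> Eb; rewrite commE // etaE ?root_opp ?ED // lieZr.
(* P_0 is applied to [x_b, h_b], a nonzero multiple of x_b: this gives eta b directly and eta (- b)
   through h_b. *)
have eta_opp b : b \in E -> eta (- b) = eta b.
  move=> Eb; have Db := ED _ Eb; have := commE b 0%N (coroot x b) Eb.
  rewrite PE // lieZr (lieC (x b)) lie_corootE ?root_opp // TpolyN TpolyZ etaE
    //.
  move/eqP; rewrite scalerN eqr_opp !scalerA -subr_eq0 -scalerBl scaler_eq0.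
  rewrite (negPf (root_vector_neq0 Db)) orbF mulrC -mulrBl mulf_eq0.
  by rewrite (negPf (ev_coroot_neq0 Db)) orbF subr_eq0 => /eqP.
have eta_sum a b : a \in E -> b \in D -> a + b \in D -> eta (a + b) = eta b.
  move=> Ea Db Dab; have [k k0 kE] := lie_roots_sum (ED _ Ea) Db Dab.
  have := commE a 0%N (x b) Ea;
    rewrite etaE // lieZr kE TpolyZ etaE // !scalerA.
  move/eqP; rewrite -subr_eq0 -scalerBl scaler_eq0.
  rewrite (negPf (root_vector_neq0 Dab)) orbF mulrC -mulrBl mulf_eq0.
  by rewrite (negPf k0) orbF subr_eq0 => /eqP.
have Esub : root_subsystem D E.
  split=> [a /ED //|a Ea|a b Ea Eb Dab].
    by rewrite EP eta_opp // E0 //=; apply/root_opp/ED.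
  rewrite EP Dab andbT eta_sum //; first exact: E0.
  exact: ED.
have commG n u v : u \in gensub E -> P n (lie u v) = lie u (P n v).
  elim/gensub_ind: u / => [|u w Hu Hw|k u Hu|a Ea|a Ea].
  - by rewrite !lie0l Tpoly0.
  - by rewrite !lieDl TpolyD Hu Hw.
  - by rewrite !lieZl TpolyZ Hu.
  - by apply: comm_h; [exact: (@vanish n) | apply/coroot_h/ED].
  exact: commE.
exists E; split=> //; exists eta.
  split=> // V [r [r_id _ _]] rV a b Ea Eb Va Vb.
  have [V_id Vs] := r_id V rV; rewrite root_subalgebraE // in V_id.
  have P0E v : P 0 v = T 0%N v by rewrite /Tpoly fact0 invr1 scale1r.
  have xa0 := root_vector_neq0 (ED _ Ea).
  have commV u w : u \in V -> T 0%N (lie u w) = lie u (T 0%N w).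
    by case: V_id => VG _ Vu; rewrite -!P0E commG //; apply: (subvP VG).
  have Ta : T 0%N (x a) = eta a *: x a by rewrite -P0E etaE ?ED.
  have := simple_eigenspace (ideal_subalgebra V_id) Vs commV Va xa0 Ta Vb.
  rewrite -P0E etaE ?ED // => /eqP; rewrite -subr_eq0 -scalerBl scaler_eq0.
  by rewrite (negPf (root_vector_neq0 (ED _ Eb))) orbF subr_eq0 => /eqP.
split.
- by move=> a Ea [|n]; [rewrite etaE ?ED | rewrite P_root0 ?ED].
- move=> a Ea [|n]; first by rewrite PE // eta_opp.
  by rewrite commE // P_root0 ?root_opp ?ED // lie0r.
- move=> n v [hv v0].
  have -> : T n v = n`!%:R *: P n v.
    by rewrite scalerA divff ?scale1r // pnatr_eq0 -lt0n fact_gt0.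
  have hP : P n v \in h.
    apply: weight0_in_h => t ht.
    by rewrite -(comm_h v (@vanish n)) // cartan_abelian // Tpoly0.
  split; first exact: memvZ.
  move=> a Ea; rewrite -/(ev a _) evZ; apply/eqP; rewrite mulf_eq0; apply/orP;
    right.
  have : lie (x a) (P n v) = 0.
    rewrite -commE // lieC lie_h_root ?ED // /ev v0 // scale0r oppr0.
    exact: Tpoly0.
  move/eqP; rewrite lieC lie_h_root ?ED // oppr_eq0 scaler_eq0.
  by rewrite (negPf (root_vector_neq0 (ED _ Ea))) orbF.
move=> b Db; rewrite EP Db andbT negbK => /eqP eta0 [|n]; last exact: P_root0.
by rewrite etaE // eta0 scale0r.
Qed.

End Necessity.

Lemma cospan_perp E t : {subset E <= D} -> t \in h ->
  exists s p, [/\ s \in cospan E, h0perp E p & t = s + p].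
Proof.
move=> ED ht; have [s Es sE] := cospan_split ED ht.
exists s, (t - s); split; rewrite ?subrKC //; split.
  by rewrite memvB // (subvP (cospan_h ED)).
by move=> a Ea; rewrite -/(ev a _) evD evN sE // subrr.
Qed.

Lemma h_rootspan t : t \in h -> t \in rootspan D -> t = 0.
Proof.
move=> ht /(span_map_uniq D_uniq)[k kE].
suff : - t = 0 by move=> /eqP; rewrite oppr_eq0 => /eqP.
by apply: (@root_dec_eq0 _ k _ _).1; rewrite ?memvN // -kE addNr.
Qed.

(** * Operators of the described form are averaging *)

Section Sufficiency.
Variables (E : seq (hdual h)) (xi : hdual h -> C) (N : nat) (T : nat ->
  'End(g)).
Hypothesis Esub : root_subsystem D E.
Hypothesis xiE : summand_constants x E xi.
Hypothesis T_desc : described D x E xi T.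

Local Notation P n u := (Tpoly T u n).

Let ED a : a \in E -> a \in D. Proof. by case: Esub => + _ _; apply. Qed.
Let EN a : a \in E -> - a \in E. Proof. by case: Esub => _ + _; apply. Qed.
Let ES a b : a \in E -> b \in E -> a + b \in D -> a + b \in E.
Proof. by case: Esub => _ _; apply. Qed.

Let P_root n a : a \in E -> P n (x a) = (if n == 0%N then xi a else 0) *: x a.
Proof. by case: T_desc => H _ _ _ Ea; rewrite H // /cpoly; case: eqP;
  rewrite ?scale0r. Qed.

Let P_coroot n a : a \in E ->
  P n (coroot x a) = (if n == 0%N then xi a else 0) *: coroot x a.
Proof. by case: T_desc => _ H _ _ Ea; rewrite H // /cpoly; case: eqP;
  rewrite ?scale0r. Qed.

Let P_out n b : b \in D -> b \notin E -> P n (x b) = 0.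
Proof. by case: T_desc => _ _ _ H Db Eb; rewrite H // /cpoly; case: eqP. Qed.

Let perp_ev p a : h0perp E p -> a \in E -> ev a p = 0.
Proof. by case=> _; apply. Qed.

Let perp_P n p : h0perp E p -> h0perp E (P n p).
Proof.
case: T_desc => _ _ H _ /(H n)[hp p0]; split; first exact: memvZ.
by move=> a Ea; rewrite -/(ev a _) evZ [ev _ _]p0 // mulr0.
Qed.

Let P_cospan n s : s \in cospan E -> P n s \in cospan E.
Proof.
elim/span_prop_ind: s / => [|s t Hs Ht|k s Hs|_ /mapP[a Ea ->]].
- by rewrite Tpoly0 mem0v.
- by rewrite TpolyD memvD.
- by rewrite TpolyZ memvZ.
by rewrite P_coroot // memvZ // coroot_cospan.
Qed.

Let P_gensub n u : u \in gensub E -> P n u \in gensub E.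
Proof.
elim/gensub_ind: u / => [|s t Hs Ht|k s Hs|a Ea|a Ea].
- by rewrite Tpoly0 mem0v.
- by rewrite TpolyD memvD.
- by rewrite TpolyZ memvZ.
- by rewrite P_coroot // memvZ // coroot_gensub.
by rewrite P_root // memvZ // root_gensub.
Qed.

Let P_gensub0 n u : u \in gensub E -> P n.+1 u = 0.
Proof.
elim/gensub_ind: u / => [|s t Hs Ht|k s Hs|a Ea|a Ea].
- by rewrite Tpoly0.
- by rewrite TpolyD Hs Ht addr0.
- by rewrite TpolyZ Hs scaler0.
- by rewrite P_coroot // scale0r.
by rewrite P_root // scale0r.
Qed.

Let perp_root p a : h0perp E p -> a \in E -> lie (x a) p = 0.
Proof.
move=> Ep Ea; have [hp _] := Ep.
by rewrite lieC lie_h_root ?ED // (perp_ev Ep) // scale0r oppr0.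
Qed.

Let perp_gensub p u : h0perp E p -> u \in gensub E -> lie u p = 0.
Proof.
move=> Ep; have [hp _] := Ep;
  elim/gensub_ind: u / => [|s t Hs Ht|k s Hs|a Ea|a Ea].
- by rewrite lie0l.
- by rewrite lieDl Hs Ht addr0.
- by rewrite lieZl Hs scaler0.
- by rewrite cartan_abelian // coroot_h ?ED.
exact: perp_root.
Qed.

(** In positive degree the image lies in h_0^perp, which commutes with [gensub E]. *)
Let gensub_P0 n u v : u \in gensub E -> lie u (P n.+1 v) = 0.
Proof.
move=> Gu; elim/generic_ind: v => [v w Hv Hw|k v Hv|t ht|b Db].
- by rewrite TpolyD lieDr Hv Hw addr0.
- by rewrite TpolyZ lieZr Hv scaler0.
- have [s [p [Es Ep ->]]] := cospan_perp ED ht.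
  rewrite TpolyD P_gensub0 ?(subvP (addvSl _ _) _ Es) // add0r.
  by rewrite perp_gensub //; apply: perp_P.
have [Eb|nEb] := boolP (b \in E); last by rewrite P_out // lie0r.
by rewrite P_gensub0 ?lie0r ?root_gensub.
Qed.

(** On the coroots and root vectors of E this is the equality of the constants of linked roots; on
    h_0^perp both sides are 0; for b outside E, a root a + b is outside E too. *)
Let root_commute a n v : a \in E -> P n (lie (x a) v) = lie (x a) (P n v).
Proof.
move=> Ea; have Da := ED Ea;
  elim/generic_ind: v => [v w Hv Hw|k v Hv|t ht|b Db].
- by rewrite lieDr !TpolyD lieDr Hv Hw.
- by rewrite lieZr !TpolyZ lieZr Hv.
- have [s [p [Es Ep ->]]] := cospan_perp ED ht.
  rewrite lieDr !TpolyD lieDr (perp_root Ep Ea) (perp_root (perp_P n Ep) Ea)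
    Tpoly0 !addr0.
  elim/span_prop_ind: s / Es => [|s r Hs Hr|k s Hs|_ /mapP[b Eb ->]].
  + by rewrite Tpoly0 !lie0r Tpoly0.
  + by rewrite lieDr !TpolyD lieDr Hs Hr.
  + by rewrite lieZr !TpolyZ lieZr Hs.
  have Db := ED Eb.
  rewrite P_coroot // lieZr lieC lie_h_root ?coroot_h // TpolyN TpolyZ P_root
    // scalerN.
  rewrite !scalerA; congr (- (_ *: _)); case: eqP => _;
    last by rewrite mul0r mulr0.
  have [->|nz] := eqVneq (ev a (coroot x b)) 0; first by rewrite mulr0 mul0r.
  by rewrite mulrC; congr (_ * _); symmetry;
    apply: (summand_linked Esub xiE) => //; right.
have [Eb|nEb] := boolP (b \in E); last first.
  rewrite P_out // lie0r; have [/eqP|ab0] := eqVneq (a + b) 0.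
    by rewrite addrC addr_eq0 => /eqP bE; rewrite bE EN in nEb.
  have [Dab|nDab] := boolP (a + b \in D);
    last by rewrite lie_roots_notin // Tpoly0.
  have [k ->] := lie_roots_line Da Db Dab; rewrite TpolyZ P_out ?scaler0 //.
  by apply: contra nEb => Eab; rewrite -(addKr a b) ES ?EN // addKr.
rewrite P_root // lieZr; have [/eqP|ab0] := eqVneq (a + b) 0.
  rewrite addrC addr_eq0 => /eqP bE; rewrite bE (summand_opp Esub xiE Ea).
  exact: P_coroot.
have [Dab|nDab] := boolP (a + b \in D); last first.
  by rewrite lie_roots_notin // Tpoly0 scaler0.
have [k ->] := lie_roots_line Da Db Dab;
  rewrite TpolyZ P_root ?ES // !scalerA mulrC.
by rewrite (summand_sum Esub xiE).
Qed.

Let gensub_commute u n v : u \in gensub E -> P n (lie u v) = lie u (P n v).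
Proof.
elim/gensub_ind: u / => [|s t Hs Ht|k s Hs|a Ea|a Ea].
- by rewrite !lie0l Tpoly0.
- by rewrite !lieDl TpolyD Hs Ht.
- by rewrite !lieZl TpolyZ Hs.
(* ad h_a is the commutator of ad x_a and ad x_(-a). *)
- have cE w : lie (coroot x a) w =
      lie (x a) (lie (x (- a)) w) - lie (x (- a)) (lie (x a) w).
    by rewrite [X in X - _]lie_leibniz addrK.
  by rewrite !cE TpolyD TpolyN !root_commute ?EN.
exact: root_commute.
Qed.

(** With [perp_image], this removes h_0^perp from both sides of the identity: [p, v] is a
    combination of root vectors outside E, which P_n kills, while P_n v lies in h plus the root
    lines of E, which p centralizes. *)
Let perp_vanish n p v : h0perp E p -> P n (lie p v) = 0.
Proof.
move=> Ep; have [hp _] := Ep;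
  elim/generic_ind: v => [v w Hv Hw|k v Hv|t ht|b Db].
- by rewrite lieDr TpolyD Hv Hw addr0.
- by rewrite lieZr TpolyZ Hv scaler0.
- by rewrite cartan_abelian // Tpoly0.
rewrite lie_h_root // TpolyZ; have [Eb|nEb] := boolP (b \in E).
  by rewrite (perp_ev Ep) // scale0r.
by rewrite P_out // scaler0.
Qed.

Let perp_image n p v : h0perp E p -> lie p (P n v) = 0.
Proof.
move=> Ep; have [hp _] := Ep;
  elim/generic_ind: v => [v w Hv Hw|k v Hv|t ht|b Db].
- by rewrite TpolyD lieDr Hv Hw addr0.
- by rewrite TpolyZ lieZr Hv scaler0.
- have [s [q [Es Eq ->]]] := cospan_perp ED ht.
  have [hq _] := perp_P n Eq.
  by rewrite cartan_abelian // TpolyD memvD // (subvP (cospan_h ED)) //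
    P_cospan.
have [Eb|nEb] := boolP (b \in E); last by rewrite P_out // lie0r.
by rewrite P_root // lieZr lieC (perp_root Ep Eb) oppr0 scaler0.
Qed.

Lemma described_averaging : averaging T.
Proof.
apply/averagingP => u v i j.
(* Only k = 0 survives, leaving [P_0 w, P_(i+j) v] up to a binomial coefficient. For i > 0 this is
   0, as i + j > 0, and so is the right side. *)
have gensub_case w : w \in gensub E ->
    \sum_(k < i.+1) 'C(i - k + j, i - k)%:R *:
      P (i - k + j) (lie (P k w) v) = lie (P i w) (P j v).
  move=> Gw; rewrite big_ord_recl /= subn0 big1 ?addr0 => [|k _]; last first.
    by rewrite /= P_gensub0 // lie0l Tpoly0 scaler0.
  case: i => [|i]; first by rewrite bin0 scale1r gensub_commute // P_gensub.
  by rewrite gensub_commute ?P_gensub // addSn gensub_P0 ?P_gensub // P_gensub0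
    // lie0l scaler0.
elim/generic_ind: u => [u w Hu Hw|c u Hu|t ht|b Db].
- rewrite TpolyD lieDl -Hu -Hw -big_split; apply: eq_bigr => k _.
  by rewrite TpolyD lieDl TpolyD scalerDr.
- rewrite TpolyZ lieZl -Hu scaler_sumr; apply: eq_bigr => k _.
  by rewrite TpolyZ lieZl TpolyZ scalerA mulrC -scalerA.
- have [s [p [Es Ep ->]]] := cospan_perp ED ht.
  rewrite TpolyD lieDl -gensub_case ?(subvP (addvSl _ _) _ Es) //.
  rewrite (perp_image j v (perp_P i Ep)) addr0; apply: eq_bigr => k _.
  by rewrite TpolyD lieDl TpolyD (perp_vanish _ _ (perp_P k Ep)) addr0.
have [Eb|nEb] := boolP (b \in E); first by rewrite gensub_case // root_gensub.
rewrite P_out // lie0l big1 // => k _.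
by rewrite P_out // lie0l Tpoly0 scaler0.
Qed.

Lemma described_scalar : scalar_on_summands x E T.
Proof.
move=> V [r [r_id _ _]] rV; have [V_id Vs] := r_id V rV.
rewrite root_subalgebraE // in V_id.
have P0E v : P 0 v = T 0%N v by rewrite /Tpoly fact0 invr1 scale1r.
have [VG _] := V_id.
case SE: [seq a <- E | x a \in V] => [|a S].
  have V0 := ideal_gensubE Esub V_id; rewrite SE gensub_nil in V0.
  case: Vs => -[]; rewrite V0; apply/eqP; rewrite -subv0.
  by apply/lie_prod_subP => u v; rewrite !memv0 => /eqP-> _; rewrite lie0l.
have : a \in [seq a <- E | x a \in V] by rewrite SE mem_head.
rewrite mem_filter => /andP[Va Ea].
exists (xi a); first by case: xiE => H _; apply: H.
have commV u w : u \in V -> T 0%N (lie u w) = lie u (T 0%N w).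
  by move=> Vu; rewrite -!P0E gensub_commute //; apply: (subvP VG).
have Ta : T 0%N (x a) = xi a *: x a by rewrite -P0E P_root.
move=> v Vv [|n]; last by rewrite P_gensub0 // (subvP VG).
rewrite P0E /cpoly /=.
exact: simple_eigenspace (ideal_subalgebra V_id) Vs commV Va (root_vector_neq0
  (ED Ea)) Ta v Vv.
Qed.

Let Tval0 u : Tval N T 0 u = P 0 u.
Proof.
rewrite /Tval big_ord_recl expr0 scale1r big1 ?addr0 // => n _.
by rewrite exprS mul0r scale0r.
Qed.

(** At alpha = 0 the operator multiplies h_a by xi a, so the coroots of E are always reached and
    only h_0^perp is in question. There, values of T_alpha on a complement do not help. *)
Lemma described_sub_Tstar :
  sub_Tstar h N T <-> forall v, h0perp E v -> Tstar N T (h0perp E) v.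
Proof.
split=> [Th v Ev|Tperp v hv]; last first.
  have [s [p [Es Ep ->]]] := cospan_perp ED hv; apply: TstarD; last first.
    case: (Tperp p Ep) => r rT pr; exists r => // w /rT[a [b _ ->]].
    by exists a; exists b.
  elim/span_prop_ind: s / Es => [|s t Hs Ht|k s Hs|_ /mapP[a Ea ->]].
  - exact: Tstar0.
  - exact: TstarD.
  - exact: TstarZ.
  have xia : xi a != 0 by case: xiE => H _; apply: H.
  rewrite -[coroot x a](scalerK xia) -[xi a *: _](P_coroot 0 Ea) -Tval0.
  exact/TstarZ/Tstar_Tval.
have [hv v0] := Ev.
(* A complement of h_0^perp in g which every T_alpha maps to itself. *)
pose W := (cospan E + rootspan D)%VS.
have [w [p [Ww Ep pT vE]]] : exists w p,
    [/\ w \in W, h0perp E p, Tstar N T (h0perp E) p & v = w + p].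
  have Tv := Th v hv; elim/Tstar_ind: v / Tv {Ev hv v0} => [|u v|k u|a b _].
  - exists 0, 0; rewrite mem0v addr0; split=> //; last exact: Tstar0.
    by split=> [|a _]; rewrite ?mem0v // -/(ev a 0) ev0.
  - move=> [w [p [Ww [hp p0] pT ->]]] [w' [p' [Ww' [hp' p'0] p'T ->]]].
    exists (w + w'), (p + p'); split; rewrite ?memvD 1?addrACA //;
      last exact: TstarD.
    split=> [|a Ea]; first exact: memvD.
    by rewrite -/(ev a _) evD [ev a p]p0 // [ev a p']p'0 // addr0.
  - move=> [w [p [Ww [hp p0] pT ->]]].
    exists (k *: w), (k *: p); split; rewrite ?memvZ ?scalerDr //;
      last exact: TstarZ.
    split=> [|a Ea]; first exact: memvZ.
    by rewrite -/(ev a _) evZ [ev a p]p0 // mulr0.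
  have TvalE u : Tval N T a u = \sum_(n < N.+1) a ^+ n *: P n u by [].
  elim/generic_ind: b => [u v|k u|t ht|b Db].
  - move=> [w [p [Ww [hp p0] pT uE]]] [w' [p' [Ww' [hp' p'0] p'T vE]]].
    exists (w + w'), (p + p'); rewrite TvalD uE vE.
    split; rewrite ?memvD 1?addrACA //; last exact: TstarD.
    split=> [|c Ec]; first exact: memvD.
    by rewrite -/(ev c _) evD [ev c p]p0 // [ev c p']p'0 // addr0.
  - move=> [w [p [Ww [hp p0] pT uE]]].
    exists (k *: w), (k *: p); rewrite TvalZ uE.
    split; rewrite ?memvZ ?scalerDr //; last exact: TstarZ.
    split=> [|c Ec]; first exact: memvZ.
    by rewrite -/(ev c _) evZ [ev c p]p0 // mulr0.
  - have [s [p [Es Ep ->]]] := cospan_perp ED ht.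
    exists (Tval N T a s), (Tval N T a p); rewrite TvalD; split=> //.
    + apply: (subvP (addvSl _ _)); rewrite TvalE.
      by apply: memv_suml => n _; rewrite memvZ // P_cospan.
    + rewrite TvalE; split; first by apply: memv_suml => n _;
      rewrite memvZ //; case: (perp_P n Ep).
      move=> c Ec; rewrite -/(ev c _) ev_sum big1 // => n _.
      by rewrite evZ (perp_ev (perp_P n Ep)) // mulr0.
    exact: Tstar_Tval.
  exists (Tval N T a (x b)), 0; rewrite addr0; split=> //; last exact: Tstar0.
    apply: (subvP (addvSr _ _)); rewrite TvalE.
    apply: memv_suml => n _; rewrite memvZ //.
    have [Eb|nEb] := boolP (b \in E); last by rewrite P_out // mem0v.
    by rewrite P_root // memvZ // root_rootspan.
  by split=> [|c _]; rewrite ?mem0v // -/(ev c 0) ev0.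
have /memv_addP[s Es [r Dr wE]] := Ww; have [hp p0] := Ep.
have hs := subvP (cospan_h ED) _ Es.
have hw : w \in h by rewrite -(addrK p w) -vE memvB.
have rE : r = w - s by rewrite wE addrC addKr.
have r0 : r = 0 by apply: h_rootspan; rewrite // rE memvB.
have w0 : w = 0.
  rewrite wE r0 addr0; apply: (cospan_perp0 ED Es) => a Ea.
  have -> : s = v - p by rewrite vE addrK wE r0 addr0.
  by rewrite evD evN [ev a v]v0 // [ev a p]p0 // subr0.
by rewrite vE w0 add0r.
Qed.

End Sufficiency.

(** T_n is glued from its prescribed restrictions to three independent summands of g: [cospan E],
    h_0^perp and the span of all root vectors. *)
Lemma described_exists E xi N (S : nat -> 'End(g)) : root_subsystem D E ->
  summand_constants x E xi ->
  (forall n v, (n <= N)%N -> h0perp E v -> h0perp E (S n v)) ->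
  exists T : nat -> 'End(g),
    [/\ degree_le N T, described D x E xi T &
        forall n v, (n <= N)%N -> h0perp E v -> T n v = S n v].
Proof.
move=> Esub xiE Sperp; have [ED EN _] := Esub.
pose kerv a := lker (a \o linfun (vsproj h) : 'Hom(g, C^o))%VF.
pose Hp := (h :&: \bigcap_(a <- E) kerv a)%VS.
have HpP v : v \in Hp <-> h0perp E v.
  have kervP a : (v \in kerv a) = (ev a v == 0).
    by rewrite memv_ker comp_lfunE lfunE.
  have capP : v \in (\bigcap_(a <- E) kerv a)%VS <-> forall a, a \in E -> ev a
    v = 0.
    elim: (E) => [|a F IHF]; first by rewrite big_nil memvf.
    rewrite big_cons memv_cap kervP; split=> [/andP[/eqP a0 /IHF F0] b|F0].
      by rewrite inE => /predU1P[-> //|/F0].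
    rewrite F0 ?mem_head // eqxx /=; apply/IHF => b Fb.
    by rewrite F0 // inE Fb orbT.
  by rewrite memv_cap; split=> [/andP[hv /capP v0]|[hv /capP v0]];
    [split | rewrite hv].
have cap1 : (cospan E :&: Hp = 0)%VS.
  apply/eqP; rewrite -subv0; apply/subvP => v; rewrite memv_cap memv0.
  case/andP=> Ev /HpP[_ v0]; apply/eqP; exact: (cospan_perp0 ED Ev).
have cap2 : (h :&: rootspan D = 0)%VS.
  apply/eqP; rewrite -subv0; apply/subvP => v; rewrite memv_cap memv0.
  by case/andP=> hv Dv; apply/eqP/h_rootspan.
(* Coroots are linearly dependent in general, so xi has to respect their relations. Against a root b
   of E only coroots with a nonzero value of b count, and these all carry the constant xi b. *)
have [theta thetaE] : exists theta : 'End(g),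
    forall a, a \in E -> theta (coroot x a) = xi a *: coroot x a.
  have [|theta thetaE] := @lfun_from_relations _ (size E) g g
    (fun i => coroot x E`_i) (fun i => xi E`_i *: coroot x E`_i).
    move=> c c0; have Ei (i : 'I_(size E)) : E`_i \in E by exact: mem_nth.
    apply: (cospan_perp0 ED) => [|b Eb].
      by apply: memv_suml => i _; rewrite !memvZ // coroot_cospan.
    transitivity (xi b * ev b (\sum_(i < size E) c i *: coroot x E`_i));
      last first.
      by rewrite c0 ev0 mulr0.
    rewrite !ev_sum mulr_sumr; apply: eq_bigr => i _;
      rewrite !evZ [RHS]mulrCA; congr (_ * _).
    have [->|nz] := eqVneq (ev b (coroot x E`_i)) 0; first by rewrite !mulr0.
    by congr (_ * _); apply: (summand_linked Esub xiE) => //; right.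
  exists theta => a Ea; have iE : (index a E < size E)%N by rewrite index_mem.
  by have := thetaE (Ordinal iE); rewrite /= nth_index.
have [phi phiE] : exists phi : 'End(g), forall a, a \in D ->
    phi (x a) = (if a \in E then xi a else 0) *: x a.
  have := linear_of_free [seq x a | a <- D]
    [seq (if a \in E then xi a else 0) *: x a | a <- D].
  have := basis_free root_basisP; rewrite cat_free => /and3P[_ freeD _].
  case=> f /(_ freeD); rewrite !size_map -map_comp => /(_ erefl) /eq_in_map fE.
  by exists (linfun f) => a Da; rewrite lfunE; apply: fE.
have TE n : exists Tn : 'End(g), [/\ forall s, s \in cospan E -> Tn s =
      (if n == 0%N then theta s else 0), forall p, h0perp E p -> Tn p = S n p
    & forall a, a \in D -> Tn (x a) = if n == 0%N then phi (x a) else 0].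
  have [f1 [f1E f1p]] := lfun_glue (if n == 0%N then theta else 0) (S n) cap1.
  have [f2 [f2h f2r]] := lfun_glue f1 (if n == 0%N then phi else 0) cap2.
  exists f2; split=> [s Es|p /[dup]-[hp _] /HpP Ep|a Da].
  - rewrite f2h ?(subvP (cospan_h ED)) // f1E //.
    by case: eqP; rewrite ?zero_lfunE.
  - by rewrite f2h // f1p.
  rewrite f2r; last exact: root_rootspan.
  by case: eqP; rewrite ?zero_lfunE.
have [T0 T0E] := choice TE.
pose T n := if (n <= N)%N then T0 n else 0.
have Tn n u : (0 < n)%N -> (forall m, (0 < m)%N -> T0 m u = 0) -> T n u = 0.
  by move=> n0 H; rewrite /T; case: leqP; rewrite ?zero_lfunE // H.
have ND b : b \in D -> forall m, (0 < m)%N -> T0 m (x b) = 0.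
  by move=> Db [|m] // _; have [_ _ ->] := T0E m.+1.
have PS u v : (forall m, (0 < m)%N -> T0 m u = 0) -> T0 0%N u = v ->
    Tpoly T u =1 cpoly v.
  move=> u0 uv [|n]; rewrite /cpoly /Tpoly /=.
    by rewrite fact0 invr1 scale1r.
  by rewrite Tn // scaler0.
exists T; split.
- by move=> n ltNn; rewrite /T leqNgt ltnNge -ltnNge ltNn.
- split.
  + move=> a Ea; apply: PS; first exact/ND/ED.
    by have [_ _ ->] := T0E 0%N; rewrite ?ED //= phiE ?ED // Ea.
  + move=> a Ea; apply: PS.
      by move=> [|m] // _; have [T0s _ _] := T0E m.+1;
        rewrite T0s ?coroot_cospan.
    by have [T0s _ _] := T0E 0%N; rewrite T0s ?coroot_cospan //= thetaE.
  + move=> n v Ev; rewrite /T; case: leqP => [leN|_].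
      by have [_ T0p _] := T0E n; rewrite T0p //; apply: Sperp.
    by rewrite zero_lfunE; split=> [|a _]; rewrite ?mem0v // -/(ev a 0) ev0.
  move=> b Db nEb; apply: PS; first exact: ND.
  by have [_ _ ->] := T0E 0%N; rewrite //= phiE // (negPf nEb) scale0r.
by move=> n v leN Ev; rewrite /T leN; have [_ T0p _] := T0E n; apply: T0p.
Qed.

End RootTheory.

Theorem mainTheorem3 (R : realType) (g : lieAlgType R[i]) (h : {vspace g})
    (D : seq (hdual h)) (x : hdual h -> g)
    (g_semisimple : lie_semisimple {:g}%VS) (h_cartan : cartan h)
    (D_roots : root_system D) (gD : root_decomposition D x) :
  [/\ (* the subalgebra attached to a root subsystem *)
      forall D', root_subsystem D D' ->
        lie_semisimple (root_subalgebra x D') /\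
        exists s, simple_decomposition (root_subalgebra x D') s,
      (* every operator is of the described form *)
      forall (N : nat) (T : nat -> 'End(g)),
        degree_le N T -> averaging T -> homogeneous N T -> sub_Tstar h N T ->
        exists D', root_subsystem D D' /\
          exists2 xi, summand_constants x D' xi & described D x D' xi T,
      (* everything of the described form is an averaging operator *)
      forall D' xi (N : nat) (T : nat -> 'End(g)),
        root_subsystem D D' -> summand_constants x D' xi ->
        degree_le N T -> described D x D' xi T ->
        [/\ averaging T, scalar_on_summands x D' T &
            sub_Tstar h N T <->
            forall v, h0perp D' v -> Tstar N T (h0perp D') v]
    & (* the restrictions to the orthogonal of D' are arbitrary *)
      forall D' xi (N : nat) (S : nat -> 'End(g)),
        root_subsystem D D' -> summand_constants x D' xi ->
        (forall n v, (n <= N)%N -> h0perp D' v -> h0perp D' (S n v)) ->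
        exists T : nat -> 'End(g),
          [/\ degree_le N T, described D x D' xi T &
              forall n v, (n <= N)%N -> h0perp D' v -> T n v = S n v]].
Proof.
split.
- move=> D' D'_sub; have [D'D D'N _] := D'_sub.
  rewrite (root_subalgebraE g_semisimple h_cartan D_roots gD D'_sub); split.
    exact: (gensub_semisimple g_semisimple h_cartan D_roots gD D'_sub).
  exact: (gensub_decomposition g_semisimple h_cartan D_roots gD D'_sub).
- move=> N T T_degree T_avg _ T_h.
  exact: (averaging_described g_semisimple h_cartan D_roots gD T_degree T_avg
    T_h).
- move=> D' xi N T D'_sub xiP _ T_desc; split.
  + exact: (described_averaging g_semisimple h_cartan D_roots gD D'_sub xiP
    T_desc).
  + exact: (described_scalar g_semisimple h_cartan D_roots gD D'_sub xiP
    T_desc).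
  exact: (described_sub_Tstar g_semisimple h_cartan D_roots gD N D'_sub xiP
    T_desc).
move=> D' xi N S.
exact: (described_exists g_semisimple h_cartan D_roots gD).
Qed.
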